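(* Let $X_*$ be an accumulation point of the sequence $\{X_k\}$ generated by the Riemannian inexact Gauss-Newton method described in the context. If the differential $\mathrm{D}H(X_* ):T_{X_*}\mathcal{Z}\to T_{H(X_* )}\mathbb{SR}^{n\times n}$ is surjective and $\|H(X_* )\|_F$ is sufficiently small, then the whole sequence $\{X_k\}$ converges to $X_*$ linearly. Furthermore, if $H(X_* )=\mathbf{0}_{n\times n}$, then the whole sequence $\{X_k\}$ converges to $X_*$ quadratically.
   Context: Notation. $\mathbb{SR}^{n\times n}$ is the space of real symmetric $n\times n$ matrices with the Frobenius inner product and norm $\|\cdot\|_F$; $\mathbf{0}_{n\times n}$ is the $n\times n$ zero matrix; $\mathcal{O}(n)$ is the set of real orthogonal $n\times n$ matrices; $\mathcal{D}(n-m)$ is the space of real diagonal matrices of order $n-m$. Problem. Given are $A_0,A_1,\dots,A_l\in\mathbb{SR}^{n\times n}$ and real numbers $\lambda_1^*\le\dots\le\lambda_m^*$ with $m\le n$. Put $\Lambda_m^*=\mathrm{diag}(\lambda_1^*,\dots,\lambda_m^* )$, $A(\mathbf{c})=A_0+\sum_{i=1}^l c_iA_i$ for $\mathbf{c}\in\mathbb{R}^l$, and $\mathcal{Z}:=\mathbb{R}^l\times\mathcal{O}(n)\times\mathcal{D}(n-m)$. Define $H:\mathcal{Z}\to\mathbb{SR}^{n\times n}$ by $H(\mathbf{c},Q,\Lambda)=A(\mathbf{c})-Q\,\mathrm{blkdiag}(\Lambda_m^*,\Lambda)\,Q^T$, where $\mathrm{blkdiag}$ denotes the block diagonal matrix,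 and $h(X)=\frac12\|H(X)\|_F^2$. The problem is to minimize $h$ over $\mathcal{Z}$. Geometry. $\mathcal{Z}$ is an embedded submanifold of $\mathbb{R}^l\times\mathbb{R}^{n\times n}\times\mathcal{D}(n-m)$ with tangent spaces $T_{(\mathbf{c},Q,\Lambda)}\mathcal{Z}=\{(\mathbf{r},Q\Omega,U):\mathbf{r}\in\mathbb{R}^l,\ \Omega\in\mathbb{R}^{n\times n},\ \Omega^T=-\Omega,\ U\in\mathcal{D}(n-m)\}$, and carries the induced Riemannian metric $\langle(\xi_1,\eta_1,\tau_1),(\xi_2,\eta_2,\tau_2)\rangle=\mathrm{tr}(\xi_1^T\xi_2)+\mathrm{tr}(\eta_1^T\eta_2)+\mathrm{tr}(\tau_1^T\tau_2)$, with norm $\|\cdot\|$ and Riemannian distance $\mathrm{dist}$, in which convergence rates are measured. $\mathrm{D}H(X):T_X\mathcal{Z}\to T_{H(X)}\mathbb{SR}^{n\times n}$ is the Riemannian differential of $H$ (the tangent space $T_{H(X)}\mathbb{SR}^{n\times n}$ is identified with $\mathbb{SR}^{n\times n}$), $(\mathrm{D}H(X))^*$ is its adjoint, and $\mathrm{grad}\,h(X)=(\mathrm{D}H(X))^*[H(X)]$ is the Riemannian gradient of $h$. $R$ is the retraction on $\mathcal{Z}$ given by $R_{(\mathbf{c},Q,\Lambda)}(\Delta\mathbf{c},\Delta Q,\Delta\Lambda)=(\mathbf{c}+\Delta\mathbf{c},R^o_Q(\Delta Q),\Lambda+\Delta\Lambda)$, where $R^o$ is a retraction on $\mathcal{O}(n)$,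 which may be chosen as $R^o_Q(\eta)=\mathrm{qf}(Q+\eta)$, with $\mathrm{qf}(\cdot)$ the $Q$-factor of the QR decomposition whose triangular factor has strictly positive diagonal. Algorithm (Riemannian inexact Gauss-Newton method). Choose $X_0\in\mathcal{Z}$, $\beta,\eta_{\max}\in(0,1)$, $\sigma\in(0,\frac12)$. For $k=0,1,2,\dots$: Step 1. Put $\eta_k=\min\{\eta_{\max},\|\mathrm{grad}\,h(X_k)\|\}$. Apply the conjugate gradient method to find an approximate solution $\Delta X_k\in T_{X_k}\mathcal{Z}$ of $(\mathrm{D}H(X_k))^*\circ\mathrm{D}H(X_k)[\Delta X_k]=-\mathrm{grad}\,h(X_k)$ such that $\|(\mathrm{D}H(X_k))^*\circ\mathrm{D}H(X_k)[\Delta X_k]+(\mathrm{D}H(X_k))^*[H(X_k)]\|\le\eta_k\|\mathrm{grad}\,h(X_k)\|$ and $\langle\mathrm{grad}\,h(X_k),\Delta X_k\rangle\le-\eta_k\langle\Delta X_k,\Delta X_k\rangle$. If these two conditions are not attainable, let $\Delta X_k=-\mathrm{grad}\,h(X_k)$. Step 2. Let $l_k$ be the smallest nonnegative integer $j$ such that $h(R_{X_k}(\beta^{j}\Delta X_k))-h(X_k)\le\sigma\beta^{j}\langle\mathrm{grad}\,h(X_k),\Delta X_k\rangle$, and set $X_{k+1}=R_{X_k}(\beta^{l_k}\Delta X_k)$. *)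

(* Defs.v *)
From HB Require Import structures.
From mathcomp Require Import all_boot all_order all_algebra.
From mathcomp Require Import all_classical all_reals all_analysis.

Set Implicit Arguments.
Unset Strict Implicit.
Unset Printing Implicit Defensive.

Import Order.TTheory GRing.Theory Num.Theory.
Import numFieldNormedType.Exports.

Local Open Scope classical_set_scope.
Local Open Scope ring_scope.

Section Smoothness.
Context {R : realType}.

(* Intended for open U: all iterated directional derivatives up to order k
   exist on U and those of order k are continuous there; in finite dimension
   this is membership in the class C^k. *)
Fixpoint Ck (V W : normedModType R) (k : nat) (U : set V) (f : V -> W) : Prop :=
  match k with
  | 0 => forall x, U x -> {for x, continuous f}
  | j.+1 => (forall x v, U x -> derivable f x v) /\
            (forall v, Ck j U ('D_v f))
  end.

(* Smoothness of a map defined on an embedded submanifold S of V: it locally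
   extends to a C^oo map on an open subset of V. *)
Definition smooth_on (V W : normedModType R) (S : set V) (f : V -> W) : Prop :=
  forall x, S x -> exists (U : set V) (F : V -> W),
    [/\ open U, U x, forall k, Ck k U F &
        forall y, S y -> U y -> f y = F y].

End Smoothness.

Section Orthogonal.
Context {R : realType} {n : nat}.

Definition orthogonal_set : set 'M[R]_n := [set Q | Q^T *m Q = 1%:M].

Definition tangent_orthogonal (Q : 'M[R]_n) : set 'M[R]_n :=
  [set e | exists2 Om : 'M[R]_n, Om^T = - Om & e = Q *m Om].

Definition tangent_bundle_orthogonal : set ('M[R]_n * 'M[R]_n) :=
  [set x | orthogonal_set x.1 /\ tangent_orthogonal x.1 x.2].

Record is_retraction_orthogonal (Ro : 'M[R]_n -> 'M[R]_n -> 'M[R]_n) : Prop := {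
  retraction_range : forall Q e, orthogonal_set Q -> tangent_orthogonal Q e ->
    orthogonal_set (Ro Q e) ;
  retraction_smooth : smooth_on tangent_bundle_orthogonal (fun x => Ro x.1 x.2) ;
  retraction_zero : forall Q, orthogonal_set Q -> Ro Q 0 = Q ;
  (* D(Ro_Q)(0)[e] = e, computed along the line t |-> t e in T_Q O(n) *)
  retraction_diff : forall Q e, orthogonal_set Q -> tangent_orthogonal Q e ->
    is_derive (0 : R) 1 (fun t : R => Ro Q (t *: e)) e }.

End Orthogonal.

Section ConjugateGradient.
Context {R : realType} {V : lmodType R}.
Variables (ip : V -> V -> R) (A : V -> V) (b : V).

(* State (x, r, d): iterate, residual b - A x, search direction. Once r = 0 the
   iterate is stationary, since 0 / 0 = 0. *)
Definition cg_step (s : V * V * V) : V * V * V :=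
  let: (x, r, d) := s in
  let a := ip r r / ip d (A d) in
  let r' := r - a *: A d in
  (x + a *: d, r', r' + (ip r' r' / ip r r) *: d).

Definition cg_iterate (i : nat) : V := (iter i cg_step (0, b, b)).1.1.

End ConjugateGradient.

(* The ambient space of the manifold Z; its last factor holds all p x p
   matrices, diagonality being imposed by Zset and tangentZ. *)
Notation ambient R l m p :=
  ('cV[R]_l * 'M[R]_(m + p) * 'M[R]_p)%type (only parsing).

Section Problem.
Context {R : realType} {l m p : nat}.

(* The order of the matrices is n = m + p, so p = n - m. *)
Local Notation n := (m + p)%N.
Local Notation ambient := (ambient R l m p).

Definition frob_ip (a b : nat) (M N : 'M[R]_(a, b)) : R := \tr (M^T *m N).
Definition frob_norm (a b : nat) (M : 'M[R]_(a, b)) : R :=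
  Num.sqrt (frob_ip M M).

Definition Zset : set ambient :=
  [set X | orthogonal_set X.1.2 /\ is_diag_mx X.2].

Definition tangentZ (X : ambient) : set ambient :=
  [set xi | tangent_orthogonal X.1.2 xi.1.2 /\ is_diag_mx xi.2].

Definition metric (x y : ambient) : R :=
  frob_ip x.1.1 y.1.1 + frob_ip x.1.2 y.1.2 + frob_ip x.2 y.2.
Definition metric_norm (x : ambient) : R := Num.sqrt (metric x x).

Definition piecewise_C1 (g : R -> ambient) : Prop :=
  exists (N : nat) (t : nat -> R),
    [/\ t 0%N = 0, t N = 1 &
        forall i, (i < N)%N -> t i < t i.+1 /\
          exists2 gi : R -> ambient, Ck 1 [set: R] gi &
            forall s, t i <= s <= t i.+1 -> g s = gi s].

Definition curve_length (g : R -> ambient) : \bar R :=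
  (\int[lebesgue_measure]_(t in `[0%R, 1%R]) (metric_norm (derive1 g t))%:E)%E.

(* Value +oo when no curve of Z joins X and Y: O(n) is not connected. *)
Definition distZ (X Y : ambient) : \bar R :=
  ereal_inf [set curve_length g | g in
    [set g | [/\ piecewise_C1 g, g 0 = X, g 1 = Y &
                 forall t, 0 <= t <= 1 -> Zset (g t)]]].

Definition retractZ (Ro : 'M[R]_n -> 'M[R]_n -> 'M[R]_n) (X xi : ambient)
    : ambient :=
  (X.1.1 + xi.1.1, Ro X.1.2 xi.1.2, X.2 + xi.2).

Variables (A0 : 'M[R]_n) (A : 'I_l -> 'M[R]_n) (lam : 'I_m -> R).

Definition Amx (c : 'cV[R]_l) : 'M[R]_n := A0 + \sum_i c i 0 *: A i.

Definition Hmap (X : ambient) : 'M[R]_n :=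
  Amx X.1.1 -
  X.1.2 *m block_mx (diag_mx (\row_i lam i)) 0 0 X.2 *m X.1.2^T.

Definition hfun (X : ambient) : R := 2^-1 * frob_norm (Hmap X) ^+ 2.

(* Z is embedded and Hmap is defined on the whole ambient space, so DH(X) is
   the restriction to the tangent space of the differential of Hmap. *)
Definition DH (X xi : ambient) : 'M[R]_n := 'd Hmap X xi.

Definition DH_surjective (X : ambient) : Prop :=
  forall S : 'M[R]_n, S^T = S -> exists2 xi, tangentZ X xi & DH X xi = S.

(* The unique tangent vector representing xi |-> <S, DH(X)[xi]>. *)
Definition DHadj (X : ambient) (S : 'M[R]_n) : ambient :=
  xget 0 [set z | tangentZ X z /\
    forall xi, tangentZ X xi -> metric z xi = frob_ip S (DH X xi)].

Definition gradh (X : ambient) : ambient := DHadj X (Hmap X).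

Definition normal_op (X xi : ambient) : ambient := DHadj X (DH X xi).

Variables (Ro : 'M[R]_n -> 'M[R]_n -> 'M[R]_n) (beta etamax sigma : R).

Definition eta (X : ambient) : R := Num.min etamax (metric_norm (gradh X)).

Definition cg_dir (X : ambient) (i : nat) : ambient :=
  cg_iterate metric (normal_op X) (- gradh X) i.

Definition acceptable (X dX : ambient) : Prop :=
  metric_norm (normal_op X dX + DHadj X (Hmap X))
    <= eta X * metric_norm (gradh X) /\
  metric (gradh X) dX <= - eta X * metric dX dX.

Definition search_direction (X dX : ambient) : Prop :=
  (exists2 i, dX = cg_dir X i & acceptable X dX) \/
  ((forall i, ~ acceptable X (cg_dir X i)) /\ dX = - gradh X).

Definition armijo (X dX : ambient) (j : nat) : Prop :=
  hfun (retractZ Ro X (beta ^+ j *: dX)) - hfun X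
    <= sigma * beta ^+ j * metric (gradh X) dX.

Definition gauss_newton_sequence (X : nat -> ambient) : Prop :=
  Zset (X 0%N) /\
  forall k, exists (dX : ambient) (lk : nat),
    [/\ search_direction (X k) dX,
        armijo (X k) dX lk,
        forall j, (j < lk)%N -> ~ armijo (X k) dX j &
        X k.+1 = retractZ Ro (X k) (beta ^+ lk *: dX)].

End Problem.

Section Rates.
Context {R : realType} {l m p : nat}.
Implicit Types (X : nat -> ambient R l m p) (Xs : ambient R l m p).

Definition converges_to X Xs : Prop :=
  (fun k => distZ (X k) Xs) @ \oo --> 0%E.

Definition converges_linearly X Xs : Prop :=
  converges_to X Xs /\
  exists2 rho : R, 0 <= rho < 1 &
    \forall k \near \oo, (distZ (X k.+1) Xs <= rho%:E * distZ (X k) Xs)%E.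

Definition converges_quadratically X Xs : Prop :=
  converges_to X Xs /\
  exists2 C : R, 0 < C &
    \forall k \near \oo, (distZ (X k.+1) Xs <= C%:E * distZ (X k) Xs ^+ 2)%E.

End Rates.

(* Main.v *)
From HB Require Import structures.
Require Import Defs.
From mathcomp Require Import all_boot all_order all_algebra.
From mathcomp Require Import all_classical all_reals all_analysis.
From mathcomp Require Import measurable_realfun ring lra.

(** The proof rests on one observation.  If Xs is stationary, the adjoint of
    DH(Xs) kills H(Xs); if DH(Xs) is also surjective onto the symmetric matrices,
    its adjoint is injective there, and H(Xs), being symmetric, is zero.  Hence an
    accumulation point as in the theorem is a solution of H = 0, near which the
    method is a Newton method for an underdetermined system, and the linear rate
    is a consequence of the quadratic one.

    Around Xs everything follows from a few uniform estimates, collected in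
    [local_model]: DH is bounded, its adjoint is bounded below by some kappa > 0
    ([DHadj_lower_bound]), and H(R_X(xi)) = H(X) + DH(X)[xi] + O(|xi|^2).  The last
    one comes from an exact expansion of the cubic map H and from
    R_Q(e) = Q + e + O(|e|^2), locally uniformly in Q ([retraction_quadratic]).

    Stationarity ([cluster_residual_zero]): if H(Xs) were not zero, the gradients
    near Xs would be bounded away from zero, the two acceptance tests would keep
    the directions bounded and gradient related, and backtracking would stop
    after boundedly many trials.  Each of the infinitely many visits near Xs would
    then lower h >= 0 by a fixed amount ([uniform_decrease]).

    Local rate ([quadratic_step]): the conjugate gradient iterates lie in the range
    of the adjoint, on which the normal operator is definite even where it is
    singular on the tangent space.  Residuals of the method are orthogonal, so it
    reaches an exact solution ([cg_exact]); near Xs this solution passes both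
    tests, so the accepted direction d is never the steepest descent fallback.
    For d in the range of the adjoint, the residual test with tolerance |grad h|
    gives |DH(X)[d] + H(X)| = O(|H(X)|^2) and |d| = O(|H(X)|), the unit step is
    accepted because sigma < 1/2, and |H| is squared at each iteration.  The steps
    are therefore summable, the sequence cannot leave a neighbourhood of Xs, and
    |X_k - Xs| is comparable with |H(X_k)| ([iterates_quadratic]).

    Rates are measured in the Riemannian distance.  It dominates the ambient norm
    ([distZ_ge], integrating along curves), and is at most 4 times the ambient
    norm between nearby points ([distZ_le]), which are joined by a Cayley curve in
    the orthogonal group. *)

Set Implicit Arguments.
Unset Strict Implicit.
Unset Printing Implicit Defensive.

Import Order.TTheory GRing.Theory Num.Theory.
Import numFieldNormedType.Exports.

Local Open Scope classical_set_scope.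
Local Open Scope ring_scope.

(** * Inner products *)

Section InnerProduct.
Context {R : realType} {V : lmodType R}.

Record inner_product (ip : V -> V -> R) : Prop := {
  ipC : forall x y, ip x y = ip y x ;
  ipDl : forall x y z, ip (x + y) z = ip x z + ip y z ;
  ipZl : forall a x z, ip (a *: x) z = a * ip x z ;
  ip_ge0 : forall x, 0 <= ip x x ;
  ip_eq0 : forall x, ip x x = 0 -> x = 0 }.

Variable ip : V -> V -> R.
Hypothesis hip : inner_product ip.
Let C := ipC hip.
Let Dl := ipDl hip.
Let Zl := ipZl hip.

Definition ipnorm (x : V) : R := Num.sqrt (ip x x).

Lemma ipDr x y z : ip z (x + y) = ip z x + ip z y.
Proof. by rewrite C Dl !(C z). Qed.

Lemma ipZr a x z : ip z (a *: x) = a * ip z x.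
Proof. by rewrite C Zl (C z). Qed.

Lemma ip0l x : ip 0 x = 0.
Proof. by rewrite -(scale0r (0 : V)) Zl mul0r. Qed.

Lemma ip0r x : ip x 0 = 0.
Proof. by rewrite C ip0l. Qed.

Lemma ipNl x y : ip (- x) y = - ip x y.
Proof. by rewrite -scaleN1r Zl mulN1r. Qed.

Lemma ipNr x y : ip y (- x) = - ip y x.
Proof. by rewrite C ipNl C. Qed.

Lemma ipBl x y z : ip (x - y) z = ip x z - ip y z.
Proof. by rewrite Dl ipNl. Qed.

Lemma ipBr x y z : ip z (x - y) = ip z x - ip z y.
Proof. by rewrite ipDr ipNr. Qed.

Lemma ip_suml I (r : seq I) (F : I -> V) z :
  ip (\sum_(i <- r) F i) z = \sum_(i <- r) ip (F i) z.
Proof.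
elim: r => [|i r IH]; first by rewrite !big_nil ip0l.
by rewrite !big_cons Dl IH.
Qed.

Lemma ipnorm_ge0 x : 0 <= ipnorm x. Proof. exact: sqrtr_ge0. Qed.

Lemma ipnorm_sqr x : ipnorm x ^+ 2 = ip x x.
Proof. by rewrite sqr_sqrtr // ip_ge0. Qed.

Lemma ipnorm0 : ipnorm 0 = 0. Proof. by rewrite /ipnorm ip0l sqrtr0. Qed.

Lemma ipnorm_eq0 x : ipnorm x = 0 -> x = 0.
Proof. by move=> x0; apply: (ip_eq0 hip); rewrite -ipnorm_sqr x0 expr0n. Qed.

Lemma ipnormZ a x : ipnorm (a *: x) = `|a| * ipnorm x.
Proof. by rewrite /ipnorm Zl ipZr mulrA -expr2 sqrtrM ?sqr_ge0 // sqrtr_sqr. Qed.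

Lemma ipnormN x : ipnorm (- x) = ipnorm x.
Proof. by rewrite -scaleN1r ipnormZ normrN1 mul1r. Qed.

Lemma ipnormB x y : ipnorm (x - y) = ipnorm (y - x).
Proof. by rewrite -ipnormN opprB. Qed.

Lemma ipnorm_le x c : 0 <= c -> ip x x <= c ^+ 2 -> ipnorm x <= c.
Proof. by move=> c0 H; rewrite -(ler_pXn2r (_ : 0 < 2)%N) ?nnegrE ?ipnorm_ge0 // ipnorm_sqr. Qed.

Lemma cauchy_schwarz_sqr x y : ip x y ^+ 2 <= ip x x * ip y y.
Proof.
have [y0|yn0] := eqVneq (ip y y) 0.
  by rewrite (ip_eq0 hip y0) !ip0r expr0n mulr0.
have ygt0 : 0 < ip y y by rewrite lt_def yn0 (ip_ge0 hip).
have := ip_ge0 hip (ip y y *: x - ip x y *: y).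
rewrite ipBl !ipBr !Zl !ipZr (C y x) => H.
have {H} : 0 <= ip y y * (ip x x * ip y y - ip x y ^+ 2).
  by apply: le_trans H _; rewrite le_eqVlt; apply/orP; left; apply/eqP; ring.
by rewrite pmulr_rge0 // subr_ge0.
Qed.

Lemma cauchy_schwarz x y : `|ip x y| <= ipnorm x * ipnorm y.
Proof.
rewrite -(ler_pXn2r (_ : 0 < 2)%N) ?nnegrE ?mulr_ge0 ?ipnorm_ge0 //.
by rewrite exprMn !ipnorm_sqr real_normK ?num_real // cauchy_schwarz_sqr.
Qed.

Lemma ler_ip x y : ip x y <= ipnorm x * ipnorm y.
Proof. exact: le_trans (ler_norm _) (cauchy_schwarz x y). Qed.

Lemma ipnormD x y : ipnorm (x + y) <= ipnorm x + ipnorm y.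
Proof.
apply: ipnorm_le; first by rewrite addr_ge0 ?ipnorm_ge0.
rewrite Dl !ipDr (C y x) sqrrD !ipnorm_sqr.
have := ler_ip x y; lra.
Qed.

Lemma ipnorm_sub x y : ipnorm (x - y) <= ipnorm x + ipnorm y.
Proof. by rewrite -(ipnormN y) ipnormD. Qed.

Lemma ipnorm_sum I (r : seq I) (F : I -> V) :
  ipnorm (\sum_(i <- r) F i) <= \sum_(i <- r) ipnorm (F i).
Proof.
elim: r => [|i r IH]; first by rewrite !big_nil ipnorm0.
by rewrite !big_cons (le_trans (ipnormD _ _)) // lerD2l.
Qed.

End InnerProduct.

(** * The Frobenius norm and the metric of the ambient space *)

Section Frobenius.
Context {R : realType}.
Implicit Types a b c : nat.

Lemma frob_ipE a b (M N : 'M[R]_(a, b)) :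
  frob_ip M N = \sum_i \sum_j M i j * N i j.
Proof.
rewrite /frob_ip /mxtrace exchange_big /=; apply: eq_bigr => j _.
by rewrite mxE; apply: eq_bigr => i _; rewrite mxE.
Qed.

Lemma frob_inner a b : inner_product (@frob_ip R a b).
Proof.
split.
- by move=> x y; rewrite !frob_ipE; do 2![apply: eq_bigr => ? _]; rewrite mulrC.
- move=> x y z; rewrite !frob_ipE -big_split; apply: eq_bigr => i _ /=.
  by rewrite -big_split; apply: eq_bigr => j _; rewrite mxE mulrDl.
- move=> k x z; rewrite !frob_ipE mulr_sumr; apply: eq_bigr => i _.
  by rewrite mulr_sumr; apply: eq_bigr => j _; rewrite mxE mulrA.
- by move=> x; rewrite frob_ipE; do 2![apply: sumr_ge0 => ? _]; rewrite -expr2 sqr_ge0.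
- move=> x /eqP; rewrite frob_ipE psumr_eq0; last first.
    by move=> i _; apply: sumr_ge0 => j _; rewrite -expr2 sqr_ge0.
  move=> /allP H; apply/matrixP => i j; rewrite mxE.
  have := H i (mem_index_enum _); rewrite /= psumr_eq0; last first.
    by move=> k _; rewrite -expr2 sqr_ge0.
  move=> /allP/(_ j (mem_index_enum _)) /=.
  by rewrite -expr2 sqrf_eq0 => /eqP.
Qed.

Lemma frob_norm_ge0 a b (M : 'M[R]_(a, b)) : 0 <= frob_norm M.
Proof. exact: ipnorm_ge0. Qed.

Lemma frob_norm_sqr a b (M : 'M[R]_(a, b)) : frob_norm M ^+ 2 = frob_ip M M.
Proof. exact: (ipnorm_sqr (frob_inner _ _)). Qed.

Lemma frob_normD a b (M N : 'M[R]_(a, b)) :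
  frob_norm (M + N) <= frob_norm M + frob_norm N.
Proof. exact: (ipnormD (frob_inner _ _)). Qed.

Lemma frob_norm_sub a b (M N : 'M[R]_(a, b)) :
  frob_norm (M - N) <= frob_norm M + frob_norm N.
Proof. exact: (ipnorm_sub (frob_inner _ _)). Qed.

Lemma frob_normB a b (M N : 'M[R]_(a, b)) : frob_norm (M - N) = frob_norm (N - M).
Proof. exact: (ipnormB (frob_inner _ _)). Qed.

Lemma frob_ip_le a b (M N : 'M[R]_(a, b)) :
  frob_ip M N <= frob_norm M * frob_norm N.
Proof. exact: (ler_ip (frob_inner _ _)). Qed.

Lemma frob_norm_sqrD a b (M N : 'M[R]_(a, b)) :
  frob_norm (M + N) ^+ 2 = frob_norm M ^+ 2 + 2 * frob_ip M N + frob_norm N ^+ 2.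
Proof.
have Fi := @frob_inner a b; rewrite !frob_norm_sqr (ipDl Fi) !(ipDr Fi).
by rewrite (ipC Fi N M); ring.
Qed.

Lemma frob_normZ a b k (M : 'M[R]_(a, b)) :
  frob_norm (k *: M) = `|k| * frob_norm M.
Proof. exact: (ipnormZ (frob_inner _ _)). Qed.

Lemma frob_normN a b (M : 'M[R]_(a, b)) : frob_norm (- M) = frob_norm M.
Proof. exact: (ipnormN (frob_inner _ _)). Qed.

Lemma frob_norm0 a b : frob_norm (0 : 'M[R]_(a, b)) = 0.
Proof. exact: (ipnorm0 (frob_inner _ _)). Qed.

Lemma frob_norm_eq0 a b (M : 'M[R]_(a, b)) : frob_norm M = 0 -> M = 0.
Proof. exact: (ipnorm_eq0 (frob_inner _ _)). Qed.

Lemma frob_ip_tr a b (M N : 'M[R]_(a, b)) : frob_ip M^T N^T = frob_ip M N.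
Proof.
by rewrite !frob_ipE exchange_big; do 2![apply: eq_bigr => ? _]; rewrite !mxE.
Qed.

Lemma frob_norm_tr a b (M : 'M[R]_(a, b)) : frob_norm M^T = frob_norm M.
Proof. by rewrite /frob_norm frob_ip_tr. Qed.

Lemma frob_ip_mull a b c (Q : 'M[R]_(a, b)) (M : 'M[R]_(b, c)) N :
  frob_ip (Q *m M) N = frob_ip M (Q^T *m N).
Proof. by rewrite /frob_ip trmx_mul mulmxA. Qed.

Lemma frob_ip_mulr a b c (Q : 'M[R]_(b, c)) (M : 'M[R]_(a, b)) N :
  frob_ip (M *m Q) N = frob_ip M (N *m Q^T).
Proof. by rewrite -frob_ip_tr trmx_mul frob_ip_mull -frob_ip_tr !trmx_mul !trmxK. Qed.

Lemma frob_norm_mulQ a b c (Q : 'M[R]_(a, b)) (M : 'M[R]_(b, c)) :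
  Q^T *m Q = 1%:M -> frob_norm (Q *m M) = frob_norm M.
Proof. by move=> hQ; rewrite /frob_norm frob_ip_mull mulmxA hQ mul1mx. Qed.

Lemma orthogonal_mulT n (Q : 'M[R]_n) : orthogonal_set Q -> Q *m Q^T = 1%:M.
Proof. by move/mulmx1C. Qed.

Lemma frob_normM a b c (M : 'M[R]_(a, b)) (N : 'M[R]_(b, c)) :
  frob_norm (M *m N) <= frob_norm M * frob_norm N.
Proof.
apply: ipnorm_le; [exact: frob_inner| by rewrite mulr_ge0 ?frob_norm_ge0|].
rewrite exprMn !frob_norm_sqr -(frob_ip_tr N) !frob_ipE mulr_suml.
apply: ler_sum => i _; rewrite mulr_sumr; apply: ler_sum => j _.
have := cauchy_schwarz_sqr (frob_inner 1 b) (row i M) (col j N)^T.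
rewrite !frob_ipE !big_ord1 -[(M *m N) i j * _]expr2.
under eq_bigr do rewrite !mxE; under [X in _ <= X * _ -> _]eq_bigr do rewrite !mxE.
under [X in _ <= _ * X -> _]eq_bigr do rewrite !mxE.
by rewrite mxE; under [X in _ -> _ <= _ * X]eq_bigr do rewrite !mxE.
Qed.

Lemma entry_le_frob a b (M : 'M[R]_(a, b)) i j : `|M i j| <= frob_norm M.
Proof.
rewrite -(ler_pXn2r (_ : 0 < 2)%N) ?nnegrE ?frob_norm_ge0 //.
rewrite real_normK ?num_real // frob_norm_sqr frob_ipE (bigD1 i) //= (bigD1 j) //=.
rewrite -expr2 -addrA lerDl addr_ge0 // sumr_ge0 // => k _; last first.
  by apply: sumr_ge0 => ? _; rewrite -expr2 sqr_ge0.
by rewrite -expr2 sqr_ge0.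
Qed.

(** The successor keeps the constant nonzero for empty matrices. *)
Lemma frob_le_entry a b (M : 'M[R]_(a, b)) (c : R) : 0 <= c ->
  (forall i j, `|M i j| <= c) -> frob_norm M <= (a * b)%N.+1%:R * c.
Proof.
move=> c0 H; apply: ipnorm_le; [exact: frob_inner|by rewrite mulr_ge0|].
rewrite frob_ipE.
apply: (@le_trans _ _ (\sum_(i < a) \sum_(j < b) c ^+ 2)).
  apply: ler_sum => i _; apply: ler_sum => j _; rewrite -expr2.
  by rewrite -[_ ^+ 2]real_normK ?num_real // ler_pXn2r ?nnegrE.
rewrite !sumr_const !card_ord -mulrnA -[X in X <= _]mulr_natl exprMn mulnC.
rewrite ler_wpM2r ?sqr_ge0 // -natrX ler_nat (leq_trans (leqnSn _)) //.
by rewrite -[leqLHS]muln1 -mulnn leq_mul.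
Qed.

Lemma mx_norm_le_frob a b (M : 'M[R]_(a, b)) : `|M| <= frob_norm M.
Proof.
rewrite /Num.norm /= mx_normrE.
by apply/bigmax_leP; split; [exact: frob_norm_ge0|move=> i _; exact: entry_le_frob].
Qed.

Lemma entry_le_mx_norm a b (M : 'M[R]_(a, b)) i j : `|M i j| <= `|M|.
Proof.
rewrite [leRHS]/Num.norm /= mx_normrE.
exact: (@le_bigmax _ _ _ 0 (fun k : 'I_a * 'I_b => `|M k.1 k.2|) (i, j)).
Qed.

Lemma frob_le_mx_norm a b (M : 'M[R]_(a, b)) :
  frob_norm M <= (a * b)%N.+1%:R * `|M|.
Proof. by apply: frob_le_entry => // i j; exact: entry_le_mx_norm. Qed.

End Frobenius.

Section Metric.
Context {R : realType} {l m p : nat}.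
Local Notation V := (ambient R l m p).
Implicit Types x y z : V.

Lemma metric_inner : inner_product (@metric R l m p).
Proof.
have F a b := @frob_inner R a b.
split.
- by move=> x y; rewrite /metric !(ipC (F _ _) x.1.1) (ipC (F _ _) x.1.2) (ipC (F _ _) x.2).
- by move=> x y z; rewrite /metric !(ipDl (F _ _)); ring.
- by move=> a x z; rewrite /metric !(ipZl (F _ _)); ring.
- by move=> x; rewrite /metric !addr_ge0 ?(ip_ge0 (F _ _)).
- move=> [[c Q] L] /eqP; rewrite /metric /= paddr_eq0 ?addr_ge0 ?(ip_ge0 (F _ _)) //.
  rewrite paddr_eq0 ?(ip_ge0 (F _ _)) // => /andP[/andP[/eqP c0 /eqP Q0] /eqP L0].
  by rewrite (ip_eq0 (F _ _) c0) (ip_eq0 (F _ _) Q0) (ip_eq0 (F _ _) L0).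
Qed.

Lemma metric_norm_ge0 x : 0 <= metric_norm x.
Proof. exact: ipnorm_ge0. Qed.

Lemma metric_norm_sqr x : metric_norm x ^+ 2 = metric x x.
Proof. exact: (ipnorm_sqr metric_inner). Qed.

Lemma metric_normD x y : metric_norm (x + y) <= metric_norm x + metric_norm y.
Proof. exact: (ipnormD metric_inner). Qed.

Lemma metric_norm_sub x y : metric_norm (x - y) <= metric_norm x + metric_norm y.
Proof. exact: (ipnorm_sub metric_inner). Qed.

Lemma metric_normB x y : metric_norm (x - y) = metric_norm (y - x).
Proof. exact: (ipnormB metric_inner). Qed.

Lemma metric_normN x : metric_norm (- x) = metric_norm x.
Proof. exact: (ipnormN metric_inner). Qed.

Lemma metric_le x y : metric x y <= metric_norm x * metric_norm y.
Proof. exact: (ler_ip metric_inner). Qed.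

Lemma metric_normZ k x : metric_norm (k *: x) = `|k| * metric_norm x.
Proof. exact: (ipnormZ metric_inner). Qed.

Lemma metric_norm0 : metric_norm (0 : V) = 0.
Proof. exact: (ipnorm0 metric_inner). Qed.

Lemma metric_sqrE x : metric_norm x ^+ 2 =
  frob_norm x.1.1 ^+ 2 + frob_norm x.1.2 ^+ 2 + frob_norm x.2 ^+ 2.
Proof. by rewrite metric_norm_sqr !frob_norm_sqr. Qed.

Lemma frob_le_metric x : [/\ frob_norm x.1.1 <= metric_norm x,
  frob_norm x.1.2 <= metric_norm x & frob_norm x.2 <= metric_norm x].
Proof.
have H := metric_sqrE x.
have := sqr_ge0 (frob_norm x.1.1); have := sqr_ge0 (frob_norm x.1.2).
have := sqr_ge0 (frob_norm x.2) => h2 h1 h0.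
by split; rewrite -(ler_pXn2r (_ : 0 < 2)%N) ?nnegrE ?frob_norm_ge0 ?metric_norm_ge0 //; lra.
Qed.

Lemma metric_le_frob x :
  metric_norm x <= frob_norm x.1.1 + frob_norm x.1.2 + frob_norm x.2.
Proof.
have h := (@frob_norm_ge0 R); have h1 := h _ _ x.1.1.
have h2 := h _ _ x.1.2; have h3 := h _ _ x.2.
rewrite -(ler_pXn2r (_ : 0 < 2)%N) ?nnegrE ?metric_norm_ge0 ?addr_ge0 //.
by rewrite metric_sqrE; nra.
Qed.

(** The topology of the ambient space comes from the maximum norm of its entries. *)
Lemma norm_le_metric x : `|x| <= metric_norm x.
Proof.
have [h1 h2 h3] := frob_le_metric x.
by rewrite !prod_normE !ge_max !(le_trans (mx_norm_le_frob _)).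
Qed.

Lemma metric_le_norm : exists2 K : R, 0 < K & forall x, metric_norm x <= K * `|x|.
Proof.
exists ((l * 1)%N.+1%:R + ((m + p) * (m + p))%N.+1%:R + (p * p)%N.+1%:R).
  by rewrite !addr_gt0 ?ltr0n.
move=> x; apply: le_trans (metric_le_frob x) _; rewrite !mulrDl.
have h1 : `|x.1| <= `|x| by rewrite prod_normE le_max lexx.
have h2 : `|x.2| <= `|x| by rewrite prod_normE le_max lexx orbT.
have h3 : `|x.1.1| <= `|x| by rewrite (le_trans _ h1) // prod_normE le_max lexx.
have h4 : `|x.1.2| <= `|x| by rewrite (le_trans _ h1) // prod_normE le_max lexx orbT.
by rewrite !lerD // (le_trans (frob_le_mx_norm _)) // ler_wpM2l.
Qed.

Lemma nbhs_metric_ball x (r : R) : 0 < r ->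
  nbhs x [set y | metric_norm (y - x) < r].
Proof.
move=> r0; have [K K0 HK] := metric_le_norm.
apply/nbhs_ballP; exists (r / K) => /=; first by rewrite divr_gt0.
move=> y; rewrite -ball_normE /= => xy.
rewrite metric_normB; apply: le_lt_trans (HK _) _.
by rewrite mulrC -ltr_pdivlMr.
Qed.

End Metric.

(** * Finite termination of the conjugate gradient method *)

Section ConjugateGradientTermination.
Context {R : realType} {V : lmodType R}.
Variables (ip : V -> V -> R) (A : V -> V) (b : V) (W : V -> Prop).
Hypothesis hip : inner_product ip.
Hypothesis WD : forall x y, W x -> W y -> W (x + y).
Hypothesis WZ : forall a x, W x -> W (a *: x).
Hypothesis Wb : W b.
Hypothesis WA : forall x, W x -> W (A x).
Hypothesis AD : forall x y, W x -> W y -> A (x + y) = A x + A y.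
Hypothesis AZ : forall a x, W x -> A (a *: x) = a *: A x.

Let st i := iter i (cg_step ip A) (0, b, b).
Let x i := (st i).1.1.
Let r i := (st i).1.2.
Let d i := (st i).2.
Let alpha i := ip (r i) (r i) / ip (d i) (A (d i)).

Let W0 : W 0. Proof. by rewrite -(scale0r b); apply: WZ. Qed.

Let A0 : A 0 = 0. Proof. by rewrite -(scale0r b) AZ // !scale0r. Qed.

Let stS i : st i.+1 = cg_step ip A (st i). Proof. by []. Qed.

Let xS i : x i.+1 = x i + alpha i *: d i.
Proof. by rewrite /x /alpha /r /d stS; case: (st i) => [[u v] w] /=. Qed.

Let rS i : r i.+1 = r i - alpha i *: A (d i).
Proof. by rewrite /alpha /r /d stS; case: (st i) => [[u v] w] /=. Qed.

Let dS i : d i.+1 = r i.+1 + (ip (r i.+1) (r i.+1) / ip (r i) (r i)) *: d i.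
Proof. by rewrite /r /d stS; case: (st i) => [[u v] w] /=. Qed.

Let WB u v : W u -> W v -> W (u - v).
Proof. by move=> Wu Wv; rewrite -scaleN1r; apply: WD => //; apply: WZ. Qed.

Let cg_inv i : [/\ W (x i), W (r i) & W (d i)].
Proof.
elim: i => [|i [Wx Wr Wd]]; first by split.
have WrS : W (r i.+1) by rewrite rS; apply: WB => //; apply: WZ; apply: WA.
split; [|exact: WrS|].
- by rewrite xS; apply: WD => //; apply: WZ.
- by rewrite dS; apply: WD => //; apply: WZ.
Qed.

(** The operator may be singular in the application; W will be the range of the
    adjoint, on which it is definite. *)
Lemma cg_iterate_sub i : W (cg_iterate ip A b i).
Proof. by have [] := cg_inv i. Qed.

Let cg_residual i : r i = b - A (x i).
Proof.
elim: i => [|i IH]; first by rewrite /r /x /= A0 subr0.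
have [Wx Wr Wd] := cg_inv i.
by rewrite rS xS AD ?AZ //; [rewrite IH opprD addrA|apply: WZ].
Qed.

Hypothesis Asym : forall x y, W x -> W y -> ip (A x) y = ip x (A y).
Hypothesis Adef : forall x, W x -> ip x (A x) = 0 -> x = 0.

Let orth_prefix k :=
  [/\ forall i j, (j < i <= k)%N -> ip (r i) (r j) = 0,
      forall i j, (j < i <= k)%N -> ip (d i) (A (d j)) = 0,
      forall i j, (j < i <= k)%N -> ip (r i) (d j) = 0 &
      forall i, (i <= k)%N -> ip (r i) (d i) = ip (r i) (r i)].

(** The classical simultaneous induction: residuals are orthogonal, directions
    are conjugate, and residuals are orthogonal to earlier directions. *)
Let cg_orth k : (forall i, (i <= k)%N -> r i != 0) -> orth_prefix k.
Proof.
elim: k => [|k IH] rn0.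
  split=> [i j|i j|i j|i].
  1-3: by rewrite leqn0 => /andP[+ /eqP i0]; rewrite i0.
  by rewrite leqn0 => /eqP->.
have [IHrr IHda IHrd IHrdi] := IH (fun i ik => rn0 i (leqW ik)).
have rr_neq0 i : (i <= k.+1)%N -> ip (r i) (r i) != 0.
  by move=> ik; apply: contra (rn0 i ik) => /eqP/(ip_eq0 hip)->.
have dAd_neq0 i : (i <= k)%N -> ip (d i) (A (d i)) != 0.
  move=> ik; have [_ _ Wd] := cg_inv i.
  apply/eqP => /(Adef Wd) d0; have := rr_neq0 i (leqW ik).
  by rewrite -IHrdi // d0 ip0r // eqxx.
have alpha_neq0 i : (i <= k)%N -> alpha i != 0.
  by move=> ik; rewrite mulf_neq0 ?invr_eq0 ?dAd_neq0 ?rr_neq0 // leqW.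
have Hrd j : (j <= k)%N -> ip (r k.+1) (d j) = 0.
  rewrite rS (ipBl hip) (ipZl hip) leq_eqVlt => /orP[/eqP->|jk].
    by rewrite (IHrdi k) // /alpha (ipC hip (A _)) divfK ?subrr ?dAd_neq0.
  have [_ _ Wdk] := cg_inv k; have [_ _ Wdj] := cg_inv j.
  rewrite IHrd ?jk ?leqnn // Asym // IHda ?jk ?leqnn //.
  by rewrite mulr0 subrr.
have Hrr j : (j <= k)%N -> ip (r k.+1) (r j) = 0.
  case: j => [|j] jk; first exact: (Hrd 0%N).
  have -> : r j.+1 = d j.+1 - (ip (r j.+1) (r j.+1) / ip (r j) (r j)) *: d j.
    by rewrite dS addrK.
  by rewrite (ipBr hip) (ipZr hip) !Hrd ?mulr0 ?subrr // ltnW.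
have Had j : (j <= k)%N -> A (d j) = (alpha j)^-1 *: (r j - r j.+1).
  by move=> jk; rewrite rS opprB addrCA subrr addr0 scalerA mulVf ?alpha_neq0 ?scale1r.
have Hda j : (j <= k)%N -> ip (d k.+1) (A (d j)) = 0.
  move=> jk; rewrite dS (ipDl hip) (ipZl hip) {1}Had // (ipZr hip) (ipBr hip) (Hrr j) // sub0r.
  move: jk; rewrite leq_eqVlt => /orP[/eqP->|jk]; last first.
    by rewrite IHda ?jk ?leqnn // Hrr // oppr0 !mulr0 addr0.
  (* The coefficient of the direction update is the one that cancels here. *)
  rewrite /alpha invf_div; have := rr_neq0 k (leqW (leqnn k)).
  by move: (ip _ (A _)) (ip (r k) _) (ip (r k.+1) _) => u v w v0; field.
have split_le i j (P : nat -> nat -> Prop) : (forall i j, (j < i <= k)%N -> P i j) ->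
    (forall j, (j <= k)%N -> P k.+1 j) -> (j < i <= k.+1)%N -> P i j.
  move=> H1 H2 /andP[ji]; rewrite leq_eqVlt => /orP[/eqP ik|ik].
    by rewrite ik in ji *; apply: H2.
  by apply: H1; rewrite ji.
split.
- by move=> i j; apply: (split_le i j (fun i j => ip (r i) (r j) = 0)).
- by move=> i j; apply: (split_le i j (fun i j => ip (d i) (A (d j)) = 0)).
- by move=> i j; apply: (split_le i j (fun i j => ip (r i) (d j) = 0)).
- move=> i; rewrite leq_eqVlt => /orP[/eqP->|]; last exact: IHrdi.
  by rewrite {1}dS (ipDr hip) (ipZr hip) Hrd // mulr0 addr0.
Qed.

Variable N : nat.
Hypothesis orth_bound : forall v : nat -> V,
  (forall i j, (j < i <= N)%N -> ip (v i) (v j) = 0) ->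
  exists2 i, (i <= N)%N & v i = 0.

(** Nonzero residuals are pairwise orthogonal, so one of the first ones vanishes. *)
Lemma cg_exact : exists i, A (cg_iterate ip A b i) = b.
Proof.
have [i ri0] : exists i, r i = 0.
  have [[i [iN ri0]]|H] := pselect (exists i, (i <= N)%N /\ r i = 0).
    by exists i.
  have rn0 i : (i <= N)%N -> r i != 0.
    by move=> iN; apply/eqP => ri0; apply: H; exists i.
  have [Hrr _ _ _] := cg_orth rn0.
  by have [i _ ri0] := orth_bound Hrr; exists i.
by exists i; apply/esym/eqP; rewrite -subr_eq0; rewrite -(cg_residual i) ri0.
Qed.

End ConjugateGradientTermination.

Lemma orthogonal_family_bound (R : realType) (V : vectType R) (ip : V -> V -> R) :
  inner_product ip -> forall v : nat -> V,
  (forall i j, (j < i <= dim V)%N -> ip (v i) (v j) = 0) ->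
  exists2 i, (i <= dim V)%N & v i = 0.
Proof.
move=> hip v vo.
have [[i [iN vi0]]|H] := pselect (exists i, (i <= dim V)%N /\ v i = 0).
  by exists i.
pose X := [tuple v i | i < (dim V).+1].
suff : free X.
  move=> fX; have := eqP fX; rewrite size_tuple => dX.
  by have := dimvS (subvf <<X>>%VS); rewrite dX dimvf ltnn.
apply/freeP => k k0 i.
have : ip (\sum_(i < (dim V).+1) k i *: X`_i) (v i) = 0 by rewrite k0 ip0l.
rewrite ip_suml // (bigD1 i) //= big1 ?addr0; last first.
  move=> j ji; rewrite (ipZl hip) (nth_map i) ?size_enum_ord // nth_ord_enum.
  have [ij|ij|/val_inj ij] := ltngtP i j.
  - by rewrite vo ?mulr0 // ij -ltnS ltn_ord.
  - by rewrite (ipC hip) vo ?mulr0 // ij -ltnS ltn_ord.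
  - by rewrite ij eqxx in ji.
rewrite (ipZl hip) (nth_map i) ?size_enum_ord // nth_ord_enum => /eqP.
rewrite mulf_eq0 => /orP[/eqP//|/eqP/(ip_eq0 hip) vi0].
by case: H; exists i; rewrite -ltnS ltn_ord.
Qed.

Lemma metric_orthogonal_bound (R : realType) (l m p : nat) :
  exists N : nat, forall v : nat -> ambient R l m p,
  (forall i j, (j < i <= N)%N -> metric (v i) (v j) = 0) ->
  exists2 i, (i <= N)%N & v i = 0.
Proof.
exists (dim ('cV[R]_l * 'M[R]_(m + p) * 'M[R]_p)%type).
exact: (@orthogonal_family_bound R ('cV[R]_l * 'M[R]_(m + p) * 'M[R]_p)%type _
  (@metric_inner R l m p)).
Qed.

(** * The map H, its differential and the adjoint *)

Section NormContinuity.
Context {R : realType}.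

Lemma continuous_of_lipschitz (V W : normedModType R) (f : V -> W) (C : R) :
  (forall x y, `|f x - f y| <= C * `|x - y|) -> continuous f.
Proof.
move=> H x; apply/cvgrPdist_le => e e0; near=> y.
apply: le_trans (H _ _) _.
apply: (@le_trans _ _ ((`|C| + 1) * `|x - y|)).
  by rewrite ler_wpM2r // (le_trans (ler_norm C)) // lerDl.
rewrite mulrC -ler_pdivlMr ?ltr_wpDl //; near: y.
by apply: cvgr_dist_le; [exact: cvg_id|rewrite divr_gt0 // ltr_wpDl].
Unshelve. all: by end_near. Qed.

Lemma diff_of_quadratic_bound (V W : normedModType R) (f : V -> W)
    (df : {linear V -> W}) (x : V) (C : R) :
  (forall z, `|df z| <= C * `|z|) ->
  (forall z, `|z| <= 1 -> `|f (x + z) - f x - df z| <= C * `|z| ^+ 2) ->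
  'd f x = df :> (V -> W).
Proof.
move=> hdf H; apply: diff_unique.
  by apply: (@continuous_of_lipschitz _ _ _ C) => u v; rewrite -linearB.
apply/eqaddoP => e e0; near=> z.
rewrite -[X in `|X|]/(f (z + x) - (f x + df z)) opprD addrA [z + x]addrC.
have z1 : `|z| <= 1 by near: z; apply: nbhs0_le.
have z2 : `|z| <= e / (`|C| + 1).
  by near: z; apply: nbhs0_le; rewrite divr_gt0 // ltr_wpDl.
rewrite ler_pdivlMr ?ltr_wpDl // in z2.
apply: le_trans (H z z1) _; rewrite [X in _ <= _ * X]/= expr2 mulrA ler_wpM2r //.
apply: le_trans z2; rewrite mulrC ler_wpM2l //.
by rewrite (le_trans (ler_norm C)) // lerDl.
Unshelve. all: by end_near. Qed.

End NormContinuity.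

Section Differential.
Context {R : realType} {l m p : nat}.
Local Notation n := (m + p)%N.
Local Notation V := (ambient R l m p).
Variables (A0 : 'M[R]_n) (A : 'I_l -> 'M[R]_n) (lam : 'I_m -> R).
Implicit Types (X xi z : V) (S : 'M[R]_n).

Local Notation H := (Hmap A0 A lam).
Local Notation DH := (DH A0 A lam).
Local Notation DHadj := (DHadj A0 A lam).

Definition spectrum_mx (L : 'M[R]_p) : 'M[R]_n :=
  block_mx (diag_mx (\row_i lam i)) 0 0 L.

Definition lower_block (U : 'M[R]_p) : 'M[R]_n := block_mx 0 0 0 U.

Lemma HmapE X : H X =
  Amx A0 A X.1.1 - X.1.2 *m spectrum_mx X.2 *m X.1.2^T.
Proof. by []. Qed.

Lemma spectrum_mxD L U : spectrum_mx (L + U) = spectrum_mx L + lower_block U.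
Proof. by rewrite /spectrum_mx /lower_block add_block_mx !addr0. Qed.

Lemma frob_lower_block U : frob_norm (lower_block U) = frob_norm U.
Proof.
rewrite /frob_norm /frob_ip /lower_block tr_block_mx mulmx_block !trmx0.
by rewrite !mul0mx !mulmx0 !add0r mxtrace_block mxtrace0 add0r.
Qed.

Lemma lower_blockD U U' : lower_block (U + U') = lower_block U + lower_block U'.
Proof. by rewrite /lower_block add_block_mx !addr0. Qed.

Lemma lower_blockZ a U : lower_block (a *: U) = a *: lower_block U.
Proof. by rewrite /lower_block scale_block_mx !scaler0. Qed.

(** The differential of H in closed form; see [DHE]. *)
Definition differential X xi : 'M[R]_n :=
  \sum_i xi.1.1 i 0 *: A i -
  (xi.1.2 *m spectrum_mx X.2 *m X.1.2^T + X.1.2 *m lower_block xi.2 *m X.1.2^T +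
   X.1.2 *m spectrum_mx X.2 *m xi.1.2^T).

Fact differential_is_linear X : linear (differential X).
Proof.
move=> a u v; rewrite /differential /= lower_blockD lower_blockZ.
have -> : (a *: u.1.2 + v.1.2)^T = a *: u.1.2^T + v.1.2^T by rewrite linearP.
have -> : \sum_i (a *: u.1.1 + v.1.1) i 0 *: A i =
    a *: (\sum_i u.1.1 i 0 *: A i) + \sum_i v.1.1 i 0 *: A i.
  rewrite scaler_sumr -big_split; apply: eq_bigr => i _ /=.
  by rewrite !mxE scalerDl scalerA.
rewrite !(mulmxDl, mulmxDr) -!(scalemxAl, scalemxAr).
by apply/matrixP => i j; rewrite !mxE; ring.
Qed.

HB.instance Definition _ X :=
  GRing.isLinear.Build R V 'M[R]_n _ (differential X) (differential_is_linear X).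

(** H is polynomial, so its Taylor expansion is an identity whose remainder is
    explicitly quadratic; this also yields the differential. *)
Lemma Hmap_expansion X z : H (X + z) - H X - differential X z =
  - (z.1.2 *m spectrum_mx X.2 *m z.1.2^T + z.1.2 *m lower_block z.2 *m X.1.2^T +
     X.1.2 *m lower_block z.2 *m z.1.2^T + z.1.2 *m lower_block z.2 *m z.1.2^T).
Proof.
rewrite !HmapE /differential /= spectrum_mxD.
have -> : (X.1.2 + z.1.2)^T = X.1.2^T + z.1.2^T by rewrite linearD.
have -> : Amx A0 A (X.1.1 + z.1.1) = Amx A0 A X.1.1 + \sum_i z.1.1 i 0 *: A i.
  rewrite /Amx -addrA -big_split; congr (_ + _); apply: eq_bigr => i _ /=.
  by rewrite mxE scalerDl.
rewrite !(mulmxDl, mulmxDr).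
by apply/matrixP => i j; rewrite !mxE; ring.
Qed.

Lemma frob_normM3 a b c d (M : 'M[R]_(a, b)) (N : 'M[R]_(b, c)) (P : 'M[R]_(c, d))
    (x y z : R) :
  frob_norm M <= x -> frob_norm N <= y -> frob_norm P <= z ->
  frob_norm (M *m N *m P) <= x * y * z.
Proof.
move=> hM hN hP; apply: le_trans (frob_normM _ _) _.
rewrite ler_pM ?frob_norm_ge0 //; apply: le_trans (frob_normM _ _) _.
by rewrite ler_pM ?frob_norm_ge0.
Qed.

Lemma Hmap_taylor X z (M : R) : frob_norm X.1.2 <= M ->
  frob_norm (spectrum_mx X.2) <= M ->
  frob_norm (H (X + z) - H X - differential X z) <=
    (3 * M + metric_norm z) * metric_norm z ^+ 2.
Proof.
move=> hQ hB; have [_ h1 h2] := frob_le_metric z.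
have h1' := h1; rewrite -frob_norm_tr in h1'.
have h2' := h2; rewrite -frob_lower_block in h2'.
have hQ' := hQ; rewrite -frob_norm_tr in hQ'.
rewrite Hmap_expansion frob_normN.
have e1 := frob_normM3 h1 hB h1'; have e2 := frob_normM3 h1 h2' hQ'.
have e3 := frob_normM3 hQ h2' h1'; have e4 := frob_normM3 h1 h2' h1'.
apply: le_trans (le_trans (frob_normD _ _) (lerD (le_trans (frob_normD _ _)
  (lerD (le_trans (frob_normD _ _) (lerD e1 e2)) e3)) e4)) _.
by rewrite le_eqVlt; apply/orP; left; apply/eqP; ring.
Qed.

Lemma differential_bound X xi (M : R) : 1 <= M -> \sum_i frob_norm (A i) <= M ->
  frob_norm X.1.2 <= M -> frob_norm (spectrum_mx X.2) <= M ->
  frob_norm (differential X xi) <= 4 * M ^+ 2 * metric_norm xi.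
Proof.
move=> M1 hA hQ hB; have [h0 h1 h2] := frob_le_metric xi.
have h1' := h1; rewrite -frob_norm_tr in h1'.
have h2' := h2; rewrite -frob_lower_block in h2'.
have hQ' := hQ; rewrite -frob_norm_tr in hQ'.
have e1 := frob_normM3 h1 hB hQ'; have e2 := frob_normM3 hQ h2' hQ'.
have e3 := frob_normM3 hQ hB h1'.
have e0 : frob_norm (\sum_i xi.1.1 i 0 *: A i) <= metric_norm xi * M.
  apply: le_trans (ipnorm_sum (frob_inner _ _) _ _) _.
  apply: le_trans (ler_wpM2l (metric_norm_ge0 _) hA); rewrite mulr_sumr.
  apply: ler_sum => i _; rewrite (ipnormZ (frob_inner _ _)).
  by rewrite ler_wpM2r ?frob_norm_ge0 // (le_trans (entry_le_frob _ _ _)).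
apply: le_trans (frob_norm_sub _ _) _.
apply: le_trans (lerD e0 (le_trans (frob_normD _ _) (lerD (le_trans (frob_normD _ _) (lerD e1 e2)) e3))) _.
have w0 := metric_norm_ge0 xi; have M0 : 0 <= M by apply: le_trans M1.
have : 0 <= metric_norm xi * M * (M - 1) by rewrite !mulr_ge0 ?subr_ge0.
lra.
Qed.

Lemma DHE X : DH X = differential X.
Proof.
have [K K0 HK] := @metric_le_norm R l m p.
pose M := 1 + \sum_i frob_norm (A i) + frob_norm X.1.2 + frob_norm (spectrum_mx X.2).
have hs : 0 <= \sum_i frob_norm (A i) by apply: sumr_ge0 => i _; exact: frob_norm_ge0.
have := frob_norm_ge0 X.1.2; have := frob_norm_ge0 (spectrum_mx X.2) => hb hq.
have M1 : 1 <= M by rewrite /M; lra.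
have C1 : 0 <= 4 * M ^+ 2 * K by apply: mulr_ge0 (ltW K0); rewrite mulr_ge0 ?sqr_ge0.
have C2 : 0 <= (3 * M + K) * K ^+ 2.
  by rewrite mulr_ge0 ?sqr_ge0 //; lra.
apply: (@diff_of_quadratic_bound _ _ _ H (differential X) X
  (4 * M ^+ 2 * K + (3 * M + K) * K ^+ 2)) => z.
  apply: le_trans (mx_norm_le_frob _) _.
  apply: le_trans (@differential_bound X _ M _ _ _ _) _; try by rewrite /M; lra.
  apply: (@le_trans _ _ (4 * M ^+ 2 * K * `|z|)).
    by rewrite -[leRHS]mulrA ler_wpM2l // mulr_ge0 // sqr_ge0.
  by rewrite ler_wpM2r // lerDl.
move=> z1; apply: le_trans (mx_norm_le_frob _) _.
apply: le_trans (@Hmap_taylor X z M _ _) _; try by rewrite /M; lra.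
have zK := HK z; have z0 := metric_norm_ge0 z; have zn0 := normr_ge0 z.
apply: (@le_trans _ _ ((3 * M + K) * (K * `|z|) ^+ 2)).
  rewrite ler_pM ?exprn_ge0 //; first by lra.
    by rewrite lerD2l; apply: le_trans zK _; rewrite -[leRHS]mulr1 ler_wpM2l // ltW.
  by rewrite ler_pXn2r ?nnegrE // mulr_ge0 // ltW.
by rewrite exprMn mulrA ler_wpM2r ?sqr_ge0 // lerDr.
Qed.

End Differential.

Section Tangent.
Context {R : realType} {l m p : nat}.
Local Notation V := (ambient R l m p).
Implicit Types (X xi : V).

Lemma tangentZD X xi xi' : tangentZ X xi -> tangentZ X xi' -> tangentZ X (xi + xi').
Proof.
move=> [[Om skew e] d] [[Om' skew' e'] d']; split.
  exists (Om + Om'); last by rewrite /= e e' mulmxDr.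
  by rewrite linearD /= skew skew' opprD.
apply/is_diag_mxP => i j ij; rewrite mxE.
by rewrite (is_diag_mxP d i j ij) (is_diag_mxP d' i j ij) addr0.
Qed.

Lemma tangentZZ X a xi : tangentZ X xi -> tangentZ X (a *: xi).
Proof.
move=> [[Om skew e] d]; split.
  exists (a *: Om); last by rewrite /= e scalemxAr.
  by rewrite linearZ /= skew scalerN.
apply/is_diag_mxP => i j ij; rewrite mxE.
by rewrite (is_diag_mxP d i j ij) mulr0.
Qed.

Lemma tangentZ0 X : tangentZ X (0 : V).
Proof.
split; first by exists 0; rewrite ?linear0 ?oppr0 ?mulmx0.
by apply/is_diag_mxP => i j _; rewrite mxE.
Qed.

Lemma tangentZ_sum X I (r : seq I) (F : I -> V) :
  (forall i, tangentZ X (F i)) -> tangentZ X (\sum_(i <- r) F i).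
Proof.
move=> H; elim/big_rec: _ => [|i xi _ Hxi]; first exact: tangentZ0.
exact: tangentZD.
Qed.

Lemma diag_mx_sym (U : 'M[R]_p) : is_diag_mx U -> U^T = U.
Proof. by move=> /diag_mxP[d ->]; rewrite tr_diag_mx. Qed.

(** Carrying a tangent vector at one base point to another by left translation
    in the orthogonal factor. *)
Definition transport (Xs X xi : V) : V :=
  (xi.1.1, X.1.2 *m (Xs.1.2^T *m xi.1.2), xi.2).

Lemma transport_tangent Xs X xi : Zset Xs -> tangentZ Xs xi ->
  tangentZ X (transport Xs X xi).
Proof.
move=> [oQ _] [[Om skew e] d]; split=> //=.
by exists Om => //; rewrite e [Xs.1.2^T *m _]mulmxA oQ mul1mx.
Qed.

Lemma transport_norm Xs X xi : Zset Xs -> Zset X -> tangentZ Xs xi ->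
  metric_norm (transport Xs X xi) = metric_norm xi.
Proof.
move=> [oQs _] [oQ _] [[Om skew e] d].
rewrite /metric_norm /metric /=; congr (Num.sqrt (_ + _ + _)).
rewrite -!frob_norm_sqr frob_norm_mulQ ?frob_norm_mulQ //.
by rewrite trmxK; exact: orthogonal_mulT.
Qed.

End Tangent.

Section Adjoint.
Context {R : realType} {l m p : nat}.
Local Notation n := (m + p)%N.
Local Notation V := (ambient R l m p).
Variables (A0 : 'M[R]_n) (A : 'I_l -> 'M[R]_n) (lam : 'I_m -> R).
Hypothesis hA0 : A0^T = A0.
Hypothesis hA : forall i, (A i)^T = A i.
Implicit Types (X xi z : V) (S : 'M[R]_n).

Local Notation H := (Hmap A0 A lam).
Local Notation DH := (DH A0 A lam).
Local Notation DHadj := (DHadj A0 A lam).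
Local Notation dH := (differential A lam).

Lemma spectrum_mx_sym (L : 'M[R]_p) : is_diag_mx L -> (spectrum_mx lam L)^T = spectrum_mx lam L.
Proof.
by move=> /diag_mx_sym hL; rewrite /spectrum_mx tr_block_mx !trmx0 tr_diag_mx hL.
Qed.

Lemma lower_block_sym (U : 'M[R]_p) : is_diag_mx U -> (@lower_block R m p U)^T = lower_block U.
Proof. by move=> /diag_mx_sym hL; rewrite /lower_block tr_block_mx !trmx0 hL. Qed.

Lemma Hmap_sym X : Zset X -> (H X)^T = H X.
Proof.
move=> [_ d]; rewrite HmapE linearB /= !trmx_mul trmxK spectrum_mx_sym // mulmxA.
congr (_ - _); rewrite /Amx linearD /= hA0; congr (_ + _).
by rewrite linear_sum; apply: eq_bigr => i _; rewrite linearZ /= hA.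
Qed.

Lemma DH_sym X xi : Zset X -> is_diag_mx xi.2 -> (DH X xi)^T = DH X xi.
Proof.
move=> [_ d] d'; rewrite DHE /differential [LHS]linearB /=.
rewrite [X in _ - X]linearD /= [X in _ - (X + _)]linearD /=.
rewrite !trmx_mul !trmxK spectrum_mx_sym // lower_block_sym // !mulmxA.
congr (_ - _); last by rewrite [RHS]addrC [RHS]addrA addrAC.
by rewrite linear_sum; apply: eq_bigr => i _; rewrite linearZ /= hA.
Qed.

(** With M = Q^T S Q one has <S, Q N Q^T> = <M, N>.  Pairing M with
    Om B - B Om gives the commutator of B and M, which is skew as B and M are
    symmetric, and pairing with a diagonal matrix retains the diagonal of the
    lower right block. *)
Definition adjoint_formula X S : V :=
  let M := X.1.2^T *m S *m X.1.2 in
  let B := spectrum_mx lam X.2 in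
  (\col_i frob_ip S (A i), X.1.2 *m (B *m M - M *m B),
   diag_mx (\row_i - drsubmx M i i)).

Lemma adjoint_formula_tangent X S : Zset X -> S^T = S ->
  tangentZ X (adjoint_formula X S).
Proof.
move=> [oQ d] sS; split; last by rewrite /= diag_mx_is_diag.
exists (spectrum_mx lam X.2 *m (X.1.2^T *m S *m X.1.2) -
        (X.1.2^T *m S *m X.1.2) *m spectrum_mx lam X.2) => //.
rewrite linearB /= !trmx_mul trmxK sS spectrum_mx_sym // opprB.
by rewrite !mulmxA.
Qed.

Lemma adjoint_formulaP X S xi : Zset X -> S^T = S -> tangentZ X xi ->
  metric (adjoint_formula X S) xi = frob_ip S (DH X xi).
Proof.
move=> [oQ d] sS [[Om skew e] d'].
have Fi := frob_inner; rewrite DHE /differential.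
rewrite (ipBr (Fi _ _ _)) !(ipDr (Fi _ _ _)) /metric /=.
set Q := X.1.2 in oQ e *; set M := Q^T *m S *m Q.
set B := spectrum_mx lam X.2.
have sM : M^T = M by rewrite /M !trmx_mul trmxK sS mulmxA.
have sB : B^T = B by exact: spectrum_mx_sym.
have conj N : frob_ip S (Q *m N *m Q^T) = frob_ip M N.
  by rewrite (ipC (Fi _ _ _)) frob_ip_mulr trmxK frob_ip_mull (ipC (Fi _ _ _)) mulmxA.
clearbody M.
have skew_ip N : frob_ip N Om^T = - frob_ip N Om by rewrite skew (ipNr (Fi _ _ _)).
have e1 : frob_ip S (xi.1.2 *m B *m Q^T) = frob_ip (M *m B) Om.
  by rewrite e -(mulmxA Q) conj frob_ip_mulr sB.
have e2 : frob_ip S (Q *m B *m xi.1.2^T) = - frob_ip (B *m M) Om.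
  by rewrite e trmx_mul mulmxA -(mulmxA Q) conj -skew_ip frob_ip_mull sB.
have e3 : frob_ip S (Q *m lower_block xi.2 *m Q^T) =
    - frob_ip (diag_mx (\row_i - drsubmx M i i)) xi.2.
  rewrite conj !frob_ipE big_split_ord /= big1 ?add0r; last first.
    move=> i _; rewrite big_split_ord /= !big1 ?addr0 // => j _.
    - by rewrite /lower_block block_mxEur [X in _ * X]mxE mulr0.
    - by rewrite /lower_block block_mxEul [X in _ * X]mxE mulr0.
  rewrite -sumrN; apply: eq_bigr => i _.
  rewrite big_split_ord /= big1 ?add0r; last first.
    by move=> j _; rewrite /lower_block block_mxEdl [X in _ * X]mxE mulr0.
  rewrite -sumrN; apply: eq_bigr => j _.
  rewrite /lower_block block_mxEdr !mxE.
  have [->|ij] := eqVneq i j; first by rewrite mulr1n mulNr opprK.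
  by rewrite (is_diag_mxP d') ?mulr0 ?oppr0.
have e4 : frob_ip S (\sum_i xi.1.1 i 0 *: A i) =
    frob_ip (\col_i frob_ip S (A i)) xi.1.1.
  rewrite (ipC (Fi _ _ _)) (ip_suml (Fi _ _ _)) frob_ipE; apply: eq_bigr => i _.
  by rewrite big_ord1 mxE (ipZl (Fi _ _ _)) (ipC (Fi _ _ _)) mulrC.
have e5 : frob_ip (Q *m (B *m M - M *m B)) xi.1.2 =
    frob_ip (B *m M) Om - frob_ip (M *m B) Om.
  by rewrite e frob_ip_mull mulmxA oQ mul1mx (ipBl (Fi _ _ _)).
rewrite e1 e2 e3 e4 e5; ring.
Qed.

(** DHadj is selected by its defining property, which therefore holds as soon as
    some vector has it. *)
Lemma DHadjP X S : Zset X -> S^T = S ->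
  tangentZ X (DHadj X S) /\
  forall xi, tangentZ X xi -> metric (DHadj X S) xi = frob_ip S (DH X xi).
Proof.
move=> ZX sS; rewrite /Defs.DHadj.
apply: (@xgetPex _ 0 [set z | tangentZ X z /\
  forall xi, tangentZ X xi -> metric z xi = frob_ip S (DH X xi)]).
exists (adjoint_formula X S); split; first exact: adjoint_formula_tangent.
by move=> xi; exact: adjoint_formulaP.
Qed.

Lemma DHadj_tangent X S : Zset X -> S^T = S -> tangentZ X (DHadj X S).
Proof. by move=> ZX sS; have [] := DHadjP ZX sS. Qed.

Lemma DHadj_ip X S xi : Zset X -> S^T = S -> tangentZ X xi ->
  metric (DHadj X S) xi = frob_ip S (DH X xi).
Proof. by move=> ZX sS; have [_] := DHadjP ZX sS; apply. Qed.

Lemma tangent_unique X z z' : tangentZ X z -> tangentZ X z' ->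
  (forall xi, tangentZ X xi -> metric z xi = metric z' xi) -> z = z'.
Proof.
move=> tz tz' h; apply/eqP; rewrite -subr_eq0; apply/eqP.
have Mi := @metric_inner R l m p; apply: (ip_eq0 Mi).
have t : tangentZ X (z - z') by rewrite -scaleN1r; apply/tangentZD/tangentZZ.
by rewrite (ipBl Mi) h ?subrr.
Qed.

Lemma DHadjD X S S' : Zset X -> S^T = S -> S'^T = S' ->
  DHadj X (S + S') = DHadj X S + DHadj X S'.
Proof.
move=> ZX sS sS'; have sSS : (S + S')^T = S + S' by rewrite linearD /= sS sS'.
apply: (@tangent_unique X); first exact: DHadj_tangent.
  by apply: tangentZD; exact: DHadj_tangent.
move=> xi t; rewrite (ipDl metric_inner) !DHadj_ip //.
by rewrite (ipDl (frob_inner _ _)).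
Qed.

Lemma DHadjZ X a S : Zset X -> S^T = S -> DHadj X (a *: S) = a *: DHadj X S.
Proof.
move=> ZX sS; have sSS : (a *: S)^T = a *: S by rewrite linearZ /= sS.
apply: (@tangent_unique X); first exact: DHadj_tangent.
  by apply: tangentZZ; exact: DHadj_tangent.
move=> xi t; rewrite (ipZl metric_inner) !DHadj_ip //.
by rewrite (ipZl (frob_inner _ _)).
Qed.

(** Combining preimages of the symmetrized matrix units linearly gives a bounded
    right inverse. *)
Lemma DH_right_inverse Xs : DH_surjective A0 A lam Xs ->
  exists2 K : R, 0 < K & forall S, S^T = S -> exists xi,
    [/\ tangentZ Xs xi, DH Xs xi = S & metric_norm xi <= K * frob_norm S].
Proof.
move=> surj.
have /choice[f hf] : forall ij : 'I_n * 'I_n, exists xi, tangentZ Xs xi /\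
    DH Xs xi = 2^-1 *: (delta_mx ij.1 ij.2 + delta_mx ij.2 ij.1).
  move=> ij; have [|xi t e] := surj (2^-1 *: (delta_mx ij.1 ij.2 + delta_mx ij.2 ij.1)).
    by rewrite linearZ linearD /= !trmx_delta addrC.
  by exists xi.
exists (1 + \sum_ij metric_norm (f ij)).
  by rewrite ltr_pwDl // sumr_ge0 // => ij _; exact: metric_norm_ge0.
move=> S sS; exists (\sum_ij S ij.1 ij.2 *: f ij); split.
- by apply: tangentZ_sum => ij; apply: tangentZZ; have [] := hf ij.
- rewrite DHE linear_sum.
  under eq_bigr => ij _.
    have := (hf ij).2; rewrite DHE linearZ /= => ->; over.
  rewrite [RHS](_ : S = 2^-1 *: (S + S^T)); last first.
    by rewrite sS; apply/matrixP => i j; rewrite !mxE; field.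
  under eq_bigr do rewrite scalerA mulrC -scalerA scalerDr.
  rewrite -scaler_sumr big_split /=; congr (_ *: (_ + _)).
    by rewrite [RHS]matrix_sum_delta pair_bigA.
  rewrite [RHS]matrix_sum_delta exchange_big pair_bigA /=.
  by apply: eq_bigr => ij _; rewrite mxE.
- apply: le_trans (ipnorm_sum metric_inner _ _) _.
  rewrite mulrDl mul1r ler_wpDl ?frob_norm_ge0 // mulr_suml; apply: ler_sum => ij _.
  rewrite (ipnormZ metric_inner) mulrC ler_wpM2l ?metric_norm_ge0 //.
  exact: entry_le_frob.
Qed.

Lemma frob_conj_diff (a b e w : R) (Q Q' N N' : 'M[R]_n) :
  frob_norm Q <= a -> frob_norm Q' <= a -> frob_norm (Q - Q') <= e ->
  frob_norm N <= b -> frob_norm (N - N') <= w -> frob_norm N' <= b ->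
  frob_norm (Q *m N *m Q^T - Q' *m N' *m Q'^T) <= 2 * (a * b * e) + a * w * a.
Proof.
move=> hQ hQ' he hN hw hN'.
have -> : Q *m N *m Q^T - Q' *m N' *m Q'^T = (Q - Q') *m N *m Q^T +
    Q' *m (N - N') *m Q^T + Q' *m N' *m (Q - Q')^T.
  rewrite [(Q - Q')^T]linearB /= !(mulmxBl, mulmxBr).
  by apply/matrixP => i j; rewrite !mxE; ring.
have hQT := hQ; rewrite -frob_norm_tr in hQT.
have heT := he; rewrite -frob_norm_tr in heT.
apply: le_trans (le_trans (frob_normD _ _) (lerD (le_trans (frob_normD _ _)
  (lerD (frob_normM3 he hN hQT) (frob_normM3 hQ' hw hQT))) (frob_normM3 hQ' hN' heT))) _.
by rewrite le_eqVlt; apply/orP; left; apply/eqP; ring.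
Qed.

Lemma DH_transport_diff Xs X xi (M : R) : 1 <= M -> Zset Xs -> Zset X -> tangentZ Xs xi ->
  frob_norm Xs.1.2 <= M -> frob_norm (spectrum_mx lam Xs.2) <= M ->
  frob_norm X.1.2 <= M -> frob_norm (spectrum_mx lam X.2) <= M ->
  frob_norm (DH X (transport Xs X xi) - DH Xs xi) <=
    8 * M ^+ 2 * metric_norm (X - Xs) * metric_norm xi.
Proof.
move=> M1 [oQs ds] [oQ dX] [[Om skew e] dU] hQs hBs hQ hB.
set B := spectrum_mx lam X.2 in hB *; set Bs := spectrum_mx lam Xs.2 in hBs *.
set Q := X.1.2 in hQ oQ *; set Qs := Xs.1.2 in hQs oQs e *.
have [_ eQ eL] := frob_le_metric (X - Xs).
have [_ w u] := frob_le_metric xi.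
have dB : B - Bs = lower_block (X.2 - Xs.2).
  apply/eqP; rewrite subr_eq addrC; apply/eqP.
  by rewrite /B /Bs -spectrum_mxD addrC subrK.
have eB : frob_norm (B - Bs) <= metric_norm (X - Xs) by rewrite dB frob_lower_block.
have wO : frob_norm Om <= metric_norm xi by rewrite -(frob_norm_mulQ Om oQs) -e.
have wOT : frob_norm Om^T <= metric_norm xi by rewrite frob_norm_tr.
pose N := Om *m B + lower_block xi.2 + B *m Om^T.
pose Ns := Om *m Bs + lower_block xi.2 + Bs *m Om^T.
have -> : DH X (transport Xs X xi) - DH Xs xi = - (Q *m N *m Q^T - Qs *m Ns *m Qs^T).
  rewrite !DHE /differential /= -/Q -/Qs -/B -/Bs e [Qs^T *m _]mulmxA oQs mul1mx.
  rewrite !trmx_mul /N /Ns !(mulmxDl, mulmxDr) !mulmxA.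
  by apply/matrixP => i j; rewrite !mxE; ring.
set d := metric_norm (X - Xs) in eQ eL eB *; set x := metric_norm xi in w u wO wOT *.
have d0 : 0 <= d by exact: metric_norm_ge0.
have x0 : 0 <= x by exact: metric_norm_ge0.
have M0 : 0 <= M by apply: le_trans M1.
have bnd C : frob_norm C <= M -> frob_norm (Om *m C + lower_block xi.2 + C *m Om^T) <= 3 * (M * x).
  move=> hC; apply: le_trans (le_trans (frob_normD _ _) (lerD (le_trans (frob_normD _ _)
    (lerD (frob_normM _ _) (lexx _))) (frob_normM _ _))) _.
  rewrite frob_lower_block.
  have h1 : frob_norm Om * frob_norm C <= x * M by rewrite ler_pM ?frob_norm_ge0.
  have h2 : frob_norm C * frob_norm Om^T <= M * x by rewrite ler_pM ?frob_norm_ge0.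
  have h3 : x * 1 <= x * M by rewrite ler_wpM2l.
  lra.
have bN := bnd B hB; have bNs := bnd Bs hBs.
have dN : frob_norm (N - Ns) <= 2 * (x * d).
  have -> : N - Ns = Om *m (B - Bs) + (B - Bs) *m Om^T.
    by rewrite /N /Ns !(mulmxBl, mulmxBr); apply/matrixP => i j; rewrite !mxE; ring.
  apply: le_trans (le_trans (frob_normD _ _) (lerD (frob_normM _ _) (frob_normM _ _))) _.
  have h1 : frob_norm Om * frob_norm (B - Bs) <= x * d by rewrite ler_pM ?frob_norm_ge0.
  have h2 : frob_norm (B - Bs) * frob_norm Om^T <= d * x by rewrite ler_pM ?frob_norm_ge0.
  lra.
rewrite frob_normN; apply: le_trans (frob_conj_diff hQ hQs eQ bN dN bNs) _.
by rewrite le_eqVlt; apply/orP; left; apply/eqP; ring.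
Qed.

(** A right inverse of DH(Xs), transported to X, inverts DH(X) up to a small
    error; by duality this bounds the adjoint from below. *)
Lemma DHadj_lower_bound Xs : Zset Xs -> DH_surjective A0 A lam Xs ->
  exists r kappa : R, [/\ 0 < r, 0 < kappa & forall X S, Zset X ->
    metric_norm (X - Xs) <= r -> S^T = S ->
    kappa * frob_norm S <= metric_norm (DHadj X S)].
Proof.
move=> Zs /DH_right_inverse[K K0 hK].
pose M := 2 + frob_norm Xs.1.2 + frob_norm (spectrum_mx lam Xs.2).
have hb := frob_norm_ge0 (spectrum_mx lam Xs.2); have hq := frob_norm_ge0 Xs.1.2.
have M1 : 1 <= M by rewrite /M; lra.
have M0 : 0 < M by apply: lt_le_trans M1.
pose c := 16 * M ^+ 2 * K; have c0 : 0 < c by rewrite !mulr_gt0 ?exprn_gt0.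
exists (Num.min 1 c^-1), (2 * K)^-1; split.
- by rewrite lt_min ltr01 invr_gt0.
- by rewrite invr_gt0 mulr_gt0.
move=> X S ZX; rewrite le_min => /andP[d1 dc] sS.
have [xi [txi hxi bxi]] := hK S sS.
have [_ eQ eL] := frob_le_metric (X - Xs).
have hQ : frob_norm X.1.2 <= M.
  rewrite -(subrK Xs.1.2 X.1.2); apply: le_trans (frob_normD _ _) _.
  by move: eQ => /=; rewrite /M; lra.
have hB : frob_norm (spectrum_mx lam X.2) <= M.
  rewrite -(subrK Xs.2 X.2) addrC spectrum_mxD; apply: le_trans (frob_normD _ _) _.
  by rewrite frob_lower_block; move: eL => /=; rewrite /M; lra.
have D := @DH_transport_diff Xs X xi M M1 Zs ZX txi _ _ hQ hB.
have {D} : frob_norm (DH X (transport Xs X xi) - S) <= 2^-1 * frob_norm S.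
  rewrite -hxi; apply: le_trans (D _ _) _; try by rewrite /M; lra.
  rewrite hxi; apply: (@le_trans _ _ (8 * M ^+ 2 * c^-1 * (K * frob_norm S))).
    by rewrite ler_pM ?mulr_ge0 ?metric_norm_ge0 ?exprn_ge0 ?(ltW M0) // ler_wpM2l // mulr_ge0 ?exprn_ge0 // ltW.
  rewrite le_eqVlt; apply/orP; left; apply/eqP; rewrite /c.
  by field; rewrite gt_eqF // gt_eqF.
have tt := transport_tangent X Zs txi.
have := frob_ip_le S (S - DH X (transport Xs X xi)).
rewrite (ipBr (frob_inner _ _)) -DHadj_ip // -frob_norm_sqr frob_normB => h1 h2.
have := metric_le (DHadj X S) (transport Xs X xi).
rewrite transport_norm // => h3.
have h4 := ler_wpM2l (frob_norm_ge0 S) h2.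
have h5 := ler_wpM2l (metric_norm_ge0 (DHadj X S)) bxi.
have [->|Sn0] := eqVneq (frob_norm S) 0; first by rewrite mulr0 metric_norm_ge0.
have S0 : 0 < frob_norm S by rewrite lt_def Sn0 frob_norm_ge0.
rewrite mulrC ler_pdivrMr ?mulr_gt0 // -(ler_pM2l S0).
lra.
Qed.

End Adjoint.

(** * Second-order expansion of the retraction *)

Section DirectionalTaylor.
Context {R : realType} {V : normedModType R}.
Implicit Types (f : V -> R) (U : set V) (x y b : V) (bs : seq V) (a : nat -> R).

Lemma is_derive_of_quadratic_bound (W : normedModType R) (g : R -> W) (t C : R) (d : W) :
  (forall h, `|h| <= 1 -> `|g (h + t) - g t - h *: d| <= C * h ^+ 2) ->
  is_derive t 1 g d.
Proof.
move=> H.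
have cv : (fun h => h^-1 *: ((g \o shift t) (h *: 1) - g t)) @ 0^' --> d.
  apply/cvgrPdist_le => e e0; near=> h.
  have hn0 : h != 0 by near: h; exact: nbhs_dnbhs_neq.
  have h1 : `|h| <= 1 by near: h; apply: dnbhs0_le.
  have he : `|h| <= e / (`|C| + 1).
    by near: h; apply: dnbhs0_le; rewrite divr_gt0 // ltr_wpDl.
  rewrite ler_pdivlMr ?ltr_wpDl // in he.
  have -> : d - h^-1 *: ((g \o shift t) (h *: 1) - g t) =
      - (h^-1 *: (g (h + t) - g t - h *: d)).
    by rewrite /= [h%:A]mulr1 !scalerBr scalerA mulVf // scale1r !opprB.
  rewrite normrN normrZ normfV ler_pdivrMl ?normr_gt0 //.
  apply: le_trans (H h h1) _; rewrite -[h ^+ 2]real_normK ?num_real // expr2 mulrA mulrC.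
  apply: ler_wpM2l => //; apply: le_trans he; rewrite mulrC ler_wpM2l //.
  by rewrite (le_trans (ler_norm C)) // lerDl.
by split; [apply/cvg_ex; exists d|apply/cvg_lim].
Unshelve. all: by end_near. Qed.

Lemma mvt_line f x b (a : R) :
  (forall c, `|c| <= `|a| -> derivable f (c *: b + x) b) ->
  exists2 c, `|c| <= `|a| & f (a *: b + x) - f x = a * 'D_b f (c *: b + x).
Proof.
move=> H; pose g (t : R) := f (t *: b + x).
have dg (t : R) : `|t| <= `|a| -> is_derive t 1 g ('D_b f (t *: b + x)).
  move=> ta; have dft := H t ta.
  have E : (fun h => h^-1 *: ((g \o shift t) (h *: 1) - g t)) =
      (fun h => h^-1 *: ((f \o shift (t *: b + x)) (h *: b) - f (t *: b + x))).
    by apply/funext => h; rewrite /g /= [h%:A]mulr1 scalerDl addrA.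
  by split; [rewrite /derivable E|rewrite /derive E].
have cg (t : R) : `|t| <= `|a| -> {for t, continuous g}.
  move=> ta; have ? := dg t ta.
  exact/differentiable_continuous/derivable1_diffP.
have g0 : g 0 = f x by rewrite /g scale0r add0r.
have [a0|a0] := leP 0 a.
  have bnd (t : R) : 0 <= t <= a -> `|t| <= `|a|.
    by move=> /andP[t0 ta]; rewrite !ger0_norm.
  have dg' t : t \in `]0, a[ -> is_derive t 1 g ('D_b f (t *: b + x)).
    by rewrite in_itv /= => /andP[t0 ta]; apply/dg/bnd; rewrite !ltW.
  have cg' : {within `[0, a], continuous g}.
    apply: continuous_in_subspaceT => t /[!inE]/=; rewrite in_itv /= => ta.
    exact/cg/bnd.
  have [t /[!in_itv]/= ta E] := MVT_segment a0 dg' cg'.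
  by exists t; [exact: bnd|move: E; rewrite g0 subr0 mulrC].
have bnd (t : R) : a <= t <= 0 -> `|t| <= `|a|.
  by move=> /andP[ta t0]; rewrite (ler0_norm t0) (ltr0_norm a0) lerN2.
have dg' t : t \in `]a, 0[ -> is_derive t 1 g ('D_b f (t *: b + x)).
  by rewrite in_itv /= => /andP[t0 ta]; apply/dg/bnd; rewrite !ltW.
have cg' : {within `[a, 0], continuous g}.
  apply: continuous_in_subspaceT => t /[!inE]/=; rewrite in_itv /= => ta.
  exact/cg/bnd.
have [t /[!in_itv]/= ta E] := MVT_segment (ltW a0) dg' cg'.
exists t; first exact: bnd.
by move: E; rewrite g0 sub0r mulrN -opprB => /oppr_inj ->; rewrite mulrC.
Qed.

Lemma Ck_entry k (r c : nat) U (F : V -> 'M[R]_(r, c)) (f : V -> R) i j :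
  open U -> Ck k U F -> (forall x, U x -> f x = F x i j) -> Ck k U f.
Proof.
move=> oU; elim: k F f => [|k IH] F f CF fF.
  move=> x Ux.
  have cF : {for x, continuous (fun x => F x i j)}.
    apply: (@continuous_comp _ _ _ F (fun M : 'M[R]_(r, c) => M i j) x).
      exact: CF.
    exact: coord_continuous.
  have E : \forall y \near x, F y i j = f y.
    by move: (open_nbhs_nbhs (conj oU Ux)); apply: filterS => y Uy; rewrite fF.
  rewrite /prop_for /continuous_at (fF x Ux); apply: cvg_trans cF.
  by apply: near_eq_cvg.
have [dF CdF] := CF.
have E x : U x -> \forall y \near x, F y i j = f y.
  move=> Ux; move: (open_nbhs_nbhs (conj oU Ux)); apply: filterS => y Uy.
  by rewrite fF.
split=> [x v Ux|v].
  apply: (near_eq_derivable (E x Ux)); apply: (derivable_mxP _ _ _).1.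
  exact: dF.
apply: (IH ('D_v F)); first exact: CdF.
move=> x Ux; rewrite -(near_eq_derive v (E x Ux)).
by rewrite derive_mx ?mxE //; exact: dF.
Qed.

Definition lincomb a bs : V := \sum_(i < size bs) a i *: bs`_i.

Lemma lincomb_cons a b bs :
  lincomb a (b :: bs) = a 0%N *: b + lincomb (fun i => a i.+1) bs.
Proof. by rewrite /lincomb /= big_ord_recl. Qed.

Lemma near_ball (g : V -> R) U x0 : open U -> U x0 -> {for x0, continuous g} ->
  exists2 r : R, 0 < r & forall y, `|y - x0| < r -> U y /\ `|g y| <= `|g x0| + 1.
Proof.
move=> oU Ux0 cg.
have : \forall y \near x0, U y /\ `|g x0 - g y| <= 1.
  apply: filterI; first exact: open_nbhs_nbhs.
  by move/cvgrPdist_le: cg; apply.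
move=> /nbhs_ballP[r /= r0 H]; exists r => // y yx.
have [|Uy gy] := H y; first by rewrite -ball_normE /= distrC.
split=> //; rewrite -(subrK (g x0) (g y)) addrC.
by rewrite (le_trans (ler_normD _ _)) // lerD2l distrC.
Qed.

Lemma near_step x0 x b (c e r : R) : `|x - x0| < r -> `|c| <= e -> e < r ->
  `|c *: b + x - x0| < r * (1 + `|b|).
Proof.
move=> xr ce er; rewrite -addrA mulrDr mulr1 addrC.
apply: le_lt_trans (ler_normD _ _) _; apply: ltr_leD => //.
by rewrite normrZ ler_wpM2r // (le_trans ce) // ltW.
Qed.

Lemma div_le_pos (r s : R) : 0 <= r -> 0 <= s -> r / (1 + s) <= r.
Proof. by move=> r0 s0; rewrite ler_pdivrMr ?ltr_pwDl // ler_peMr // lerDl. Qed.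

(** Telescoping along the vectors of bs keeps every bound uniform in the
    coefficients, which the definition of Ck, stated direction by direction,
    does not give at once. *)
Lemma C1_lipschitz f U x0 bs : open U -> U x0 -> Ck 1 U f ->
  exists r L : R, [/\ 0 < r, 0 <= L & forall x a e, `|x - x0| < r -> e < r ->
    (forall i, `|a i| <= e) -> `|f (lincomb a bs + x) - f x| <= L * e].
Proof.
move=> oU Ux0 [df cdf]; elim: bs => [|b bs [r' [L' [r'0 L'0 IH]]]].
  exists 1, 0; split=> // x a e _ _ _.
  by rewrite /lincomb big_ord0 add0r subrr normr0 mul0r.
have [r1 r10 H1] := near_ball oU Ux0 (cdf b x0 Ux0).
pose r := Num.min r1 r' / (1 + `|b|).
have b1 : 0 < 1 + `|b| by rewrite ltr_pwDl.
have m0 : 0 < Num.min r1 r' by rewrite lt_min r10.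
have rb : r * (1 + `|b|) = Num.min r1 r' by rewrite divfK // gt_eqF.
have rle : r <= Num.min r1 r' by apply: div_le_pos => //; exact: ltW.
move: (rle); rewrite le_min => /andP[rr1 rr'].
exists r, (L' + (`|'D_b f x0| + 1)); split; first by rewrite divr_gt0.
  by rewrite !addr_ge0.
move=> x a e xr er ha.
have step c : `|c| <= e -> `|c *: b + x - x0| < Num.min r1 r'.
  by move=> ce; rewrite -rb; apply: near_step xr ce er.
have [|c ca E] := @mvt_line f x b (a 0%N).
  move=> c ca; apply: df; apply: (H1 _ _).1.
  by have := step c (le_trans ca (ha 0%N)); rewrite lt_min => /andP[].
rewrite lincomb_cons -addrA addrCA.
rewrite -(subrK (f (a 0%N *: b + x)) (f (lincomb _ _ + _))) -addrA.
apply: le_trans (ler_normD _ _) _; rewrite mulrDl lerD //.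
  apply: IH => //; last by apply: lt_le_trans er _.
  by have := step _ (ha 0%N); rewrite lt_min => /andP[].
rewrite E normrM mulrC ler_pM //.
apply: (H1 _ _).2; have := step c (le_trans ca (ha 0%N)).
by rewrite lt_min => /andP[].
Qed.

(** The change, along one more vector b, of the first-order terms for bs. *)
Lemma C2_derivatives_lipschitz f U x0 b bs : open U -> U x0 -> Ck 2 U f ->
  exists r L : R, [/\ 0 < r, 0 <= L & forall x a c e, `|x - x0| < r -> e < r ->
    (forall i, `|a i| <= e) -> `|c| <= e ->
    `|\sum_(i < size bs) a i * ('D_(bs`_i) f (c *: b + x) - 'D_(bs`_i) f x)|
       <= L * e ^+ 2].
Proof.
move=> oU Ux0 [_ cdf]; elim: bs => [|b' bs [r' [L' [r'0 L'0 IH]]]].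
  by exists 1, 0; split=> // x a c e _ _ _ _; rewrite big_ord0 normr0 mul0r.
have [r1 [L1 [r10 L10 H1]]] := @C1_lipschitz ('D_b' f) U x0 [:: b] oU Ux0 (cdf b').
exists (Num.min r1 r'), (L1 + L'); split; rewrite ?lt_min ?r10 ?addr_ge0 //.
move=> x a c e; rewrite !lt_min => /andP[xr1 xr'] /andP[er1 er'] ha ce.
rewrite big_ord_recl mulrDl; apply: le_trans (ler_normD _ _) _; rewrite lerD //.
  rewrite normrM expr2 mulrA mulrC ler_pM //.
  have := H1 x (fun=> c) e xr1 er1 (fun=> ce).
  by rewrite lincomb_cons /lincomb big_ord0 addr0.
exact: (IH x (fun i => a i.+1)).
Qed.

Lemma C2_taylor f U x0 bs : open U -> U x0 -> Ck 2 U f ->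
  exists r L : R, [/\ 0 < r, 0 <= L & forall x a e, `|x - x0| < r -> e < r ->
    (forall i, `|a i| <= e) ->
    `|f (lincomb a bs + x) - f x - \sum_(i < size bs) a i * 'D_(bs`_i) f x|
       <= L * e ^+ 2].
Proof.
move=> oU Ux0 Cf; elim: bs => [|b bs [r' [L' [r'0 L'0 IH]]]].
  exists 1, 0; split=> // x a e _ _ _.
  by rewrite /lincomb !big_ord0 add0r !subrr normr0 mul0r.
have [r1 [L1 [r10 L10 H1]]] := @C1_lipschitz ('D_b f) U x0 [:: b] oU Ux0 (Cf.2 b).
have [r2 [L2 [r20 L20 H2]]] := C2_derivatives_lipschitz b bs oU Ux0 Cf.
have [r3 r30 H3] := @near_ball (cst 0) U x0 oU Ux0 (cvg_cst _).
pose rm := Num.min (Num.min r1 r2) (Num.min r3 r').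
pose r := rm / (1 + `|b|).
have b1 : 0 < 1 + `|b| by rewrite ltr_pwDl.
have m0 : 0 < rm by rewrite !lt_min r10 r20 r30.
have rb : r * (1 + `|b|) = rm by rewrite divfK // gt_eqF.
have rle : r <= rm by apply: div_le_pos => //; exact: ltW.
exists r, (L' + (L2 + L1)); split; first by rewrite divr_gt0.
  by rewrite !addr_ge0.
move=> x a e xr er ha.
have step c : `|c| <= e -> `|c *: b + x - x0| < rm.
  by move=> ce; rewrite -rb; apply: near_step xr ce er.
have xrm := lt_le_trans xr rle; have erm := lt_le_trans er rle.
move: (xrm) (erm); rewrite !lt_min => /andP[/andP[x1 x2] /andP[x3 x']] /andP[/andP[e1 e2] /andP[e3 e']].
have [|c ca E] := @mvt_line f x b (a 0%N).
  move=> c ca; apply: Cf.1; apply: (H3 _ _).1.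
  by have := step c (le_trans ca (ha 0%N)); rewrite !lt_min => /andP[_ /andP[]].
set y := a 0%N *: b + x; set a' := fun i => a i.+1.
have -> : lincomb a (b :: bs) + x = lincomb a' bs + y.
  by rewrite lincomb_cons -addrA addrCA.
have -> : \sum_(i < size (b :: bs)) a i * 'D_((b :: bs)`_i) f x =
    a 0%N * 'D_b f x + \sum_(i < size bs) a' i * 'D_(bs`_i) f x.
  by rewrite big_ord_recl.
have yr' : `|y - x0| < r'.
  by have := step _ (ha 0%N); rewrite !lt_min => /andP[_ /andP[]].
have -> : f (lincomb a' bs + y) - f x - (a 0%N * 'D_b f x +
      \sum_(i < size bs) a' i * 'D_(bs`_i) f x) =
    (f (lincomb a' bs + y) - f y - \sum_(i < size bs) a' i * 'D_(bs`_i) f y) +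
    (\sum_(i < size bs) a' i * ('D_(bs`_i) f y - 'D_(bs`_i) f x) +
     a 0%N * ('D_b f (c *: b + x) - 'D_b f x)).
  have -> : \sum_(i < size bs) a' i * ('D_(bs`_i) f y - 'D_(bs`_i) f x) =
      \sum_(i < size bs) a' i * 'D_(bs`_i) f y - \sum_(i < size bs) a' i * 'D_(bs`_i) f x.
    by rewrite -sumrB; apply: eq_bigr => i _; rewrite mulrBr.
  by rewrite mulrBr -E /y; ring.
apply: le_trans (ler_normD _ _) _; rewrite mulrDl lerD //.
  by apply: IH => // i; exact: ha.
apply: le_trans (ler_normD _ _) _; rewrite mulrDl lerD //.
  by apply: H2 => // i; exact: ha.
rewrite normrM expr2 mulrA mulrC ler_pM //.
have := H1 x (fun=> c) e x1 e1 (fun=> le_trans ca (ha 0%N)).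
by rewrite lincomb_cons /lincomb big_ord0 addr0.
Qed.

End DirectionalTaylor.

Section RetractionExpansion.
Context {R : realType} {n : nat}.
Variable Ro : 'M[R]_n -> 'M[R]_n -> 'M[R]_n.
Hypothesis hRo : is_retraction_orthogonal Ro.

Lemma lincomb_map (V : normedModType R) (I : Type) (s : seq I) (F : I -> V) (c : I -> R) :
  lincomb (fun i => [seq c k | k <- s]`_i) [seq F k | k <- s] = \sum_(k <- s) c k *: F k.
Proof.
elim: s => [|k s IH]; first by rewrite /lincomb /= big_ord0 big_nil.
by rewrite lincomb_cons big_cons /= IH.
Qed.

Lemma sum_pair0 (I : Type) (s : seq I) (c : I -> R) (D : I -> 'M[R]_n) :
  \sum_(k <- s) c k *: ((0, D k) : 'M[R]_n * 'M[R]_n) = (0, \sum_(k <- s) c k *: D k).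
Proof.
elim: s => [|k s IH]; first by rewrite !big_nil.
by rewrite !big_cons IH; congr pair; rewrite /= scaler0 addr0.
Qed.

(** Each matrix entry of the retraction comes with its own radius and constant. *)
Lemma uniform_constants (I : finType) (P : I -> R -> R -> Prop) :
  (forall i r r' L L', 0 < r' <= r -> L <= L' -> P i r L -> P i r' L') ->
  (forall i, exists r L, [/\ 0 < r, 0 <= L & P i r L]) ->
  exists r L, [/\ 0 < r, 0 <= L & forall i, P i r L].
Proof.
move=> mono H.
have /choice[f hf] : forall i, exists rL : R * R, [/\ 0 < rL.1, 0 <= rL.2 & P i rL.1 rL.2].
  by move=> i; have [r [L ?]] := H i; exists (r, L).
have s0 (g : I -> R) : (forall i, 0 <= g i) -> forall i, g i <= \sum_j g j.
  by move=> g0 i; rewrite (bigD1 i) //= lerDl sumr_ge0.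
have v0 i : 0 <= (f i).1^-1 by have [r0 _ _] := hf i; rewrite invr_ge0 ltW.
have L0 i : 0 <= (f i).2 by have [_ ? _] := hf i.
have S0 : 0 < 1 + \sum_j (f j).1^-1 by rewrite ltr_pwDl // sumr_ge0.
exists (1 + \sum_j (f j).1^-1)^-1, (\sum_j (f j).2); split.
- by rewrite invr_gt0.
- by rewrite sumr_ge0.
move=> i; have [r0 _ Pi] := hf i; apply: mono Pi; last exact: (s0 (fun i => (f i).2)).
rewrite invr_gt0 S0 /= -[leRHS]invrK lef_pV2 ?posrE ?invr_gt0 //.
by rewrite (le_trans (s0 _ v0 i)) // lerDr.
Qed.

(** A smooth extension F of the retraction has, entry by entry, a second-order
    expansion at (Q, 0) that is uniform for Q near Qs.  Its first-order term at a
    tangent vector e is e, because both it and e are the derivative at 0 of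
    t |-> R_Q(t e). *)
Lemma retraction_quadratic Qs : orthogonal_set Qs ->
  exists r L : R, [/\ 0 < r, 0 <= L & forall Q e, orthogonal_set Q ->
    tangent_orthogonal Q e -> frob_norm (Q - Qs) < r -> frob_norm e < r ->
    frob_norm (Ro Q e - Q - e) <= L * frob_norm e ^+ 2].
Proof.
move=> oQs.
have tb0 : tangent_bundle_orthogonal (Qs, 0 : 'M[R]_n).
  by split=> //=; exists 0; rewrite ?trmx0 ?oppr0 ?mulmx0.
have [U [F [oU Ux0 CF RF]]] := retraction_smooth hRo tb0.
have [r1 r10 H1] := @near_ball R _ (cst 0) U (Qs, 0) oU Ux0 (cvg_cst _).
pose bs := [seq ((0, delta_mx k.1 k.2) : 'M[R]_n * 'M[R]_n) | k <- enum {: 'I_n * 'I_n}].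
pose co (e : 'M[R]_n) i := [seq e k.1 k.2 | k <- enum {: 'I_n * 'I_n}]`_i.
have co_le e i : `|co e i| <= frob_norm e.
  have [ie|ie] := ltnP i (size (enum {: 'I_n * 'I_n})); last first.
    have -> : co e i = 0 by rewrite /co nth_default // size_map.
    by rewrite normr0 frob_norm_ge0.
  have /mapP[k _ ->] : co e i \in [seq e k.1 k.2 | k <- enum {: 'I_n * 'I_n}].
    by rewrite mem_nth // size_map.
  exact: entry_le_frob.
have coZ (t : R) e i : co (t *: e) i = t * co e i.
  have [ie|ie] := ltnP i (size (enum {: 'I_n * 'I_n})); last first.
    by rewrite /co !nth_default ?mulr0 // size_map.
  have k0 : 'I_n * 'I_n by case: (enum _) ie => [//|k0 s] _; exact: k0.
  by rewrite /co !(nth_map k0) ?mxE -?enumT.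
(* Only the second factor varies: e is expanded in the matrix units. *)
have lc e : lincomb (co e) bs = (0, e).
  rewrite lincomb_map sum_pair0; congr pair.
  by rewrite big_enum [RHS]matrix_sum_delta pair_bigA.
pose P (ij : 'I_n * 'I_n) (r L : R) := forall Q e, frob_norm (Q - Qs) < r ->
  frob_norm e < r -> `|F (Q, e) ij.1 ij.2 - F (Q, 0) ij.1 ij.2 -
    \sum_(k < size bs) co e k * 'D_(bs`_k) (fun x => F x ij.1 ij.2) (Q, 0)|
  <= L * frob_norm e ^+ 2.
have [||r2 [L [r20 L0 HT]]] := @uniform_constants _ P.
- move=> ij r r' L L' /andP[_ rr'] LL' HP Q e hQ he.
  apply: le_trans (HP Q e (lt_le_trans hQ rr') (lt_le_trans he rr')) _.
  by rewrite ler_wpM2r ?sqr_ge0.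
- move=> ij; have Cij : Ck 2 U (fun x => F x ij.1 ij.2).
    exact: (@Ck_entry _ _ _ _ _ U F _ ij.1 ij.2 oU (CF 2%N)).
  have [r [L [r0 L0 H]]] := C2_taylor bs oU Ux0 Cij.
  exists r, L; split=> // Q e hQ he.
  have QQ : `|(Q, 0) - (Qs, 0) : 'M[R]_n * 'M[R]_n| < r.
    rewrite prod_normE /= subr0 normr0 gt_max r0 andbT.
    exact: le_lt_trans (mx_norm_le_frob _) hQ.
  have := H (Q, 0) (co e) (frob_norm e) QQ he (co_le e).
  rewrite lc.
  have -> // : ((0, e) + (Q, 0) : 'M[R]_n * 'M[R]_n) = (Q, e).
  by congr pair; rewrite /= ?add0r ?addr0.
exists (Num.min r1 r2), ((n * n)%N.+1%:R * L); split.
- by rewrite lt_min r10.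
- by rewrite mulr_ge0.
move=> Q e oQ te; rewrite !lt_min => /andP[Q1 Q2] /andP[e1 e2].
have eF (t : R) : `|t| <= 1 -> Ro Q (t *: e) = F (Q, t *: e).
  move=> t1; apply: (RF (Q, t *: e)).
    split=> //=; have [Om sk ->] := te; exists (t *: Om).
      by rewrite linearZ /= sk scalerN.
    by rewrite scalemxAr.
  apply: (H1 _ _).1; rewrite prod_normE /= subr0 gt_max.
  rewrite (le_lt_trans (mx_norm_le_frob _)) //= (le_lt_trans (mx_norm_le_frob _)) //.
  by rewrite frob_normZ (le_lt_trans _ e1) // ler_piMl ?frob_norm_ge0.
have R0 : F (Q, 0) = Q.
  by have := eF 0; rewrite scale0r (retraction_zero hRo oQ) normr0 => h; exact/esym/h.
have R1 : Ro Q e = F (Q, e) by have := eF 1; rewrite scale1r normr1 => ->.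
rewrite -mulrA; apply: frob_le_entry; first by rewrite mulr_ge0 ?sqr_ge0.
move=> i j; set S := \sum_(k < size bs) co e k * 'D_(bs`_k) (fun x => F x i j) (Q, 0).
have bnd (t : R) : `|t| <= 1 ->
    `|Ro Q (t *: e) i j - Q i j - t * S| <= L * (frob_norm e ^+ 2) * t ^+ 2.
  move=> t1; rewrite eF //.
  have -> : Q i j = F (Q, 0) i j by rewrite R0.
  have te2 : frob_norm (t *: e) < r2.
    by rewrite frob_normZ (le_lt_trans _ e2) // ler_piMl ?frob_norm_ge0.
  have := HT (i, j) Q (t *: e) Q2 te2.
  rewrite frob_normZ exprMn real_normK ?num_real // mulrA mulrAC.
  apply: le_trans; rewrite le_eqVlt; apply/orP; left; apply/eqP; congr (`|_ - _|).
  rewrite /S mulr_sumr; apply: eq_bigr => k _; rewrite mulrA; congr (_ * _).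
  exact/esym/coZ.
have d1 : is_derive (0 : R) (1 : R) (fun t : R => Ro Q (t *: e) i j) S.
  apply: (@is_derive_of_quadratic_bound _ _ _ _ (L * frob_norm e ^+ 2)) => h h1.
  by rewrite addr0 scale0r (retraction_zero hRo oQ); exact: bnd.
have [dR vR] := retraction_diff hRo oQ te.
have d2 : 'D_1 (fun t : R => Ro Q (t *: e) i j) 0 = e i j.
  by move: vR; rewrite derive_mx // => /matrixP/(_ i j) <-; rewrite mxE.
have SE : S = e i j by rewrite -d2; apply/esym/derive_val.
have := bnd 1; rewrite scale1r normr1 mul1r expr1n mulr1 SE !mxE.
exact.
Qed.

End RetractionExpansion.

(** * The Riemannian distance and the ambient norm *)

Section LengthLowerBound.
Context {R : realType} {l m p : nat}.
Local Notation V := (ambient R l m p).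
Implicit Types (g gi : R -> V) (w : V) (t : nat -> R).

Lemma metric_le_C w : exists C : R, forall x : V, `|metric w x| <= C * `|x|.
Proof.
have [K K0 HK] := @metric_le_norm R l m p.
exists (metric_norm w * K) => x.
apply: le_trans (cauchy_schwarz metric_inner w x) _.
by rewrite -mulrA ler_wpM2l ?metric_norm_ge0 //; exact: HK.
Qed.

Lemma metric_continuous w : continuous (fun x : V => metric w x).
Proof.
have [C hC] := metric_le_C w.
apply: (@continuous_of_lipschitz _ _ _ _ C) => x y.
by rewrite -(ipBr metric_inner); exact: hC.
Qed.

Lemma metric_norm_continuous : continuous (@metric_norm R l m p).
Proof.
have [K K0 HK] := @metric_le_norm R l m p.
apply: (@continuous_of_lipschitz _ _ _ _ K) => x y.
apply: le_trans (HK _); rewrite ler_norml.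
have := metric_normD (x - y) y; have := metric_normD (y - x) x.
by rewrite !subrK metric_normB => h1 h2; apply/andP; split; lra.
Qed.

Lemma is_derive_metric w gi (s : R) : derivable gi s 1 ->
  is_derive s (1 : R) (fun s : R => metric w (gi s)) (metric w ('D_1 gi s)).
Proof.
move=> /cvg_ex[d gd].
have -> : 'D_1 gi s = d by apply/cvg_lim.
have cv : (fun h => h^-1 *: (((fun s : R => metric w (gi s)) \o shift s) (h *: 1) -
    metric w (gi s))) @ 0^' --> metric w d.
  have -> : (fun h => h^-1 *: (((fun s : R => metric w (gi s)) \o shift s) (h *: 1) -
      metric w (gi s))) =
      (metric w) \o (fun h : R => h^-1 *: ((gi \o shift s) (h *: 1) - gi s)).
    apply/funext => h /=; rewrite (ipZr metric_inner) (ipBr metric_inner).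
    by [].
  by apply: continuous_cvg gd; exact: metric_continuous.
by split; [apply/cvg_ex; exists (metric w d)|apply/cvg_lim].
Qed.

Lemma derive1_near_eq g gi (a b s : R) : a < s < b ->
  (forall s, a <= s <= b -> g s = gi s) -> derive1 g s = 'D_1 gi s.
Proof.
move=> /andP[as_ sb] E; rewrite derive1E; apply: near_eq_derive.
have : s \in `]a, b[ by rewrite in_itv /= as_ sb.
move=> /near_in_itvoo; apply: filterS => y; rewrite in_itv /= => /andP[ay yb].
by apply: E; rewrite !ltW.
Qed.

Local Notation mu := (@lebesgue_measure R).

(** By the fundamental theorem of calculus and the Cauchy-Schwarz inequality.  A
    fixed direction w makes the bounds of successive arcs add up; the open interval
    leaves out the nodes, where g need not be differentiable. *)
Lemma arc_length_ge g gi (a b : R) w : metric_norm w <= 1 -> a < b -> Ck 1 [set: R] gi ->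
  (forall s, a <= s <= b -> g s = gi s) ->
  measurable_fun `]a, b[ (fun s => metric_norm (derive1 g s)) /\
  ((metric w (g b) - metric w (g a))%:E <=
    \int[mu]_(s in `]a, b[) (metric_norm (derive1 g s))%:E)%E.
Proof.
move=> w1 ab [dgi cgi] E.
have cd : continuous ('D_1 gi) by move=> s; exact: (cgi 1 s I).
have cn : continuous (fun s => metric_norm ('D_1 gi s)).
  move=> s; apply: (@continuous_comp _ _ _ ('D_1 gi) (@metric_norm R l m p)).
    exact: cd.
  exact: metric_norm_continuous.
have cm : continuous (fun s => metric w ('D_1 gi s)).
  move=> s; apply: (@continuous_comp _ _ _ ('D_1 gi) (fun x : V => metric w x)).
    exact: cd.
  exact: metric_continuous.
have En s : s \in `]a, b[ -> metric_norm ('D_1 gi s) = metric_norm (derive1 g s).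
  by rewrite in_itv /= => sab; rewrite (derive1_near_eq sab E).
have mn : measurable_fun [set: R] (fun s => metric_norm ('D_1 gi s)).
  exact: continuous_measurable_fun.
have mf : measurable_fun `]a, b[ (fun s => metric_norm (derive1 g s)).
  apply: (@eq_measurable_fun _ _ _ _ _ (fun s => metric_norm ('D_1 gi s))).
    by move=> s; rewrite inE => sab; exact: En.
  exact: measurable_funS mn.
split=> //.
have -> : (\int[mu]_(s in `]a, b[) (metric_norm (derive1 g s))%:E =
    \int[mu]_(s in `[a, b]) (metric_norm ('D_1 gi s))%:E)%E.
  rewrite [RHS]integral_itv_bndoo; last first.
    by apply/measurable_EFinP; exact: measurable_funS mn.
  by apply: eq_integral => s; rewrite inE /= => sab; rewrite En.
have cw s : {for s, continuous (fun s : R => metric w (gi s))}.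
  apply/differentiable_continuous/derivable1_diffP.
  by have [] := is_derive_metric w (dgi s 1 I).
have FTC : (\int[mu]_(s in `[a, b]) (metric w ('D_1 gi s))%:E =
    (metric w (gi b))%:E - (metric w (gi a))%:E)%E.
  apply: (@continuous_FTC2 _ (fun s => metric w ('D_1 gi s)) (fun s => metric w (gi s)) a b ab).
  - by apply: continuous_in_subspaceT => s _; exact: cm.
  - split.
    + by move=> s _; have [] := is_derive_metric w (dgi s 1 I).
    + by apply: cvg_at_right_filter; exact: cw.
    + by apply: cvg_at_left_filter; exact: cw.
  - move=> s _; rewrite derive1E.
    by have [_] := is_derive_metric w (dgi s 1 I).
have ci (f : R -> R) : continuous f -> mu.-integrable `[a, b] (EFin \o f).
  move=> cf; apply: continuous_compact_integrable; first exact: segment_compact.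
  by apply: continuous_in_subspaceT => s _; exact: cf.
rewrite EFinB !E ?lexx ?(ltW ab) // -FTC.
have I1 := ci _ cm; have I2 := ci _ cn.
apply: le_integral => //.
move=> s _; rewrite lee_fin; apply: le_trans (metric_le _ _) _.
by rewrite ler_piMl ?metric_norm_ge0.
Qed.

Lemma curve_length_ge g : piecewise_C1 g ->
  ((metric_norm (g 1 - g 0))%:E <= curve_length g)%E.
Proof.
move=> [N [t [t0 tN H]]].
have [->|un0] := eqVneq (metric_norm (g 1 - g 0)) 0.
  by apply: integral_ge0 => s _; rewrite lee_fin metric_norm_ge0.
have u0 : 0 < metric_norm (g 1 - g 0) by rewrite lt_def un0 metric_norm_ge0.
(* The direction in which the whole displacement is seen. *)
pose w := (metric_norm (g 1 - g 0))^-1 *: (g 1 - g 0).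
have w1 : metric_norm w <= 1.
  by rewrite metric_normZ ger0_norm ?invr_ge0 ?metric_norm_ge0 // mulVf.
have -> : metric_norm (g 1 - g 0) = metric w (g 1) - metric w (g 0).
  rewrite -(ipBr metric_inner) (ipZl metric_inner) -metric_norm_sqr expr2 mulrA.
  by rewrite mulVf // mul1r.
pose f s := metric_norm (derive1 g s).
have f0 s : 0 <= f s by exact: metric_norm_ge0.
have step k : (k <= N)%N -> [/\ 0 <= t k, measurable_fun `[0, t k[ f &
    ((metric w (g (t k)) - metric w (g 0))%:E <= \int[mu]_(s in `[0%R, t k[) (f s)%:E)%E].
  elim: k => [|k IH] kN.
    rewrite t0 subrr set_itvxx; split=> //; first exact: measurable_fun_set0.
    by rewrite integral_set0.
  have [tk mk ik] := IH (ltnW kN).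
  have [tt [gi Cgi Egi]] := H k kN.
  have [mf lf] := arc_length_ge w1 tt Cgi Egi.
  have mf' : measurable_fun `[t k, t k.+1[ f by exact/measurable_fun_itv_obnd_cbndP.
  have itvU : `[0, t k.+1[%classic = `[0, t k[%classic `|` `[t k, t k.+1[%classic.
    by apply: itv_bndbnd_setU; rewrite bnd_simp // ltW.
  have mU : measurable_fun (`[0, t k[%classic `|` `[t k, t k.+1[%classic) f.
    exact/measurable_funU.
  split; [by rewrite (le_trans tk) // ltW|by rewrite itvU|].
  rewrite itvU ge0_integral_setU //; last 3 first.
  - exact/measurable_EFinP.
  - by move=> s _; rewrite lee_fin f0.
  - rewrite disj_set2E; apply/eqP; rewrite -subset0 => s [] /=.
    by rewrite !in_itv /= => /andP[_ h1] /andP[h2 _]; move: h1; rewrite ltNge h2.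
  rewrite -[X in (_ <= _ + X)%E]integral_itv_obnd_cbnd; last exact/measurable_EFinP.
  apply: le_trans (leeD ik lf); rewrite -EFinD lee_fin; lra.
have [_ mN] := step N (leqnn N); rewrite tN in mN * => lN.
by rewrite /curve_length -integral_itv_bndo_bndc //; exact/measurable_EFinP.
Qed.

Lemma distZ_ge (X Y : V) : ((metric_norm (X - Y))%:E <= distZ X Y)%E.
Proof.
apply: le_ereal_inf_tmp => _ [g [Cg g0 g1 _] <-].
by rewrite metric_normB -g0 -g1; exact: curve_length_ge.
Qed.

End LengthLowerBound.

Section CayleyCurve.
Context {R : realType}.

Lemma unitmx_of_expansive n (M : 'M[R]_n) :
  (forall u : 'rV_n, frob_norm u <= frob_norm (u *m M)) -> M \in unitmx.
Proof.
move=> H; rewrite -row_free_unit; apply: inj_row_free => v vM.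
have := H v; rewrite vM frob_norm0 => v0; apply: frob_norm_eq0.
by apply/eqP; rewrite eq_le v0 frob_norm_ge0.
Qed.

(** N and N W are orthogonal when W is skew, so adding a multiple of N W to N can
    only lengthen it. *)
Lemma skew_expansive a n (W : 'M[R]_n) (N : 'M[R]_(a, n)) (t : R) : W^T = - W ->
  frob_norm N <= frob_norm (N *m (1%:M + t *: W)).
Proof.
move=> skew; have Fi := @frob_inner R a n.
have NW : frob_ip N (N *m W) = 0.
  have := frob_ip_mulr W N N; rewrite skew mulmxN (ipNr Fi) (ipC Fi) => e; lra.
rewrite -(ler_pXn2r (_ : 0 < 2)%N) ?nnegrE ?frob_norm_ge0 // !frob_norm_sqr.
rewrite mulmxDr mulmx1 -scalemxAr (ipDl Fi) !(ipDr Fi) !(ipZl Fi) !(ipZr Fi).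
rewrite (ipC Fi (N *m W) N) NW !mulr0 addr0 add0r lerDl mulrA -expr2.
by rewrite mulr_ge0 ?sqr_ge0 // (ip_ge0 Fi).
Qed.

Section Resolvent.
Variables (n : nat) (W : 'M[R]_n).
Hypothesis skew : W^T = - W.
Implicit Types s t : R.

Definition resolvent t : 'M[R]_n := invmx (1%:M + t *: W).

Lemma resolvent_unit t : 1%:M + t *: W \in unitmx.
Proof. by apply: unitmx_of_expansive => u; exact: skew_expansive. Qed.

Lemma resolvent_mulr a (N : 'M[R]_(a, n)) t :
  frob_norm (N *m resolvent t) <= frob_norm N.
Proof.
apply: le_trans (skew_expansive _ t skew) _.
by rewrite -mulmxA mulVmx ?mulmx1 ?resolvent_unit.
Qed.

Lemma resolvent_tr t : (resolvent t)^T = invmx (1%:M - t *: W).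
Proof. by rewrite /resolvent trmx_inv linearD /= trmx1 linearZ /= skew scalerN. Qed.

Lemma resolvent_diff s t :
  resolvent s - resolvent t = (t - s) *: (resolvent s *m W *m resolvent t).
Proof.
transitivity (resolvent s *m ((1%:M + t *: W) - (1%:M + s *: W)) *m resolvent t).
  rewrite mulmxBr mulmxBl -mulmxA mulmxV ?resolvent_unit // mulmx1.
  by rewrite mulVmx ?resolvent_unit // mul1mx.
by rewrite opprD addrACA subrr add0r -scalerBl -scalemxAr -scalemxAl.
Qed.

(** The Cayley transform (1 - t W) (1 + t W)^-1, written so that its variation is
    that of the resolvent. *)
Definition cayley t : 'M[R]_n := 2 *: resolvent t - 1%:M.

(** The derivative of [cayley], by the resolvent identity. *)
Definition cayley' t : 'M[R]_n := - (2 *: (resolvent t *m W *m resolvent t)).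

Lemma cayley0 : cayley 0 = 1%:M.
Proof.
rewrite /cayley /resolvent scale0r addr0 invmx1.
by apply/matrixP => i j; rewrite !mxE; ring.
Qed.

Lemma cayleyE t : cayley t = (1%:M - t *: W) *m resolvent t.
Proof.
have -> : 1%:M - t *: W = 2 *: 1%:M - (1%:M + t *: W).
  by apply/matrixP => i j; rewrite !mxE; ring.
by rewrite mulmxBl mulmxV ?resolvent_unit // -scalemxAl mul1mx.
Qed.

Lemma cayley_orthogonal t : orthogonal_set (cayley t).
Proof.
have u : 1%:M - t *: W \in unitmx by rewrite -scaleNr resolvent_unit.
have -> : orthogonal_set (cayley t) = ((cayley t)^T *m cayley t = 1%:M) by [].
have E : (cayley t)^T = (1%:M + t *: W) *m invmx (1%:M - t *: W).
  rewrite /cayley linearB linearZ /= resolvent_tr trmx1.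
  have -> : 1%:M + t *: W = 2 *: 1%:M - (1%:M - t *: W).
    by apply/matrixP => i j; rewrite !mxE; ring.
  by rewrite mulmxBl mulmxV // -scalemxAl mul1mx.
rewrite E cayleyE mulmxA -[_ *m invmx _ *m _]mulmxA mulVmx // mulmx1.
by rewrite mulmxV ?resolvent_unit.
Qed.

End Resolvent.

Lemma resolvent_mull n (W : 'M[R]_n) b (N : 'M[R]_(n, b)) t : W^T = - W ->
  frob_norm (resolvent W t *m N) <= frob_norm N.
Proof.
move=> skew; have skewN : (- W)^T = - - W by rewrite linearN /= skew.
rewrite -frob_norm_tr trmx_mul resolvent_tr // -[X in _ <= X]frob_norm_tr.
by have := resolvent_mulr skewN N^T t; rewrite /resolvent scalerN.
Qed.

Section CayleyEstimates.
Variables (n : nat) (W : 'M[R]_n).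
Hypothesis skew : W^T = - W.
Implicit Types s t : R.
Local Notation Y := (resolvent W).

Lemma resolvent_sandwich t : frob_norm (Y t *m W *m Y t) <= frob_norm W.
Proof.
by apply: le_trans (resolvent_mulr skew _ _) _; exact: resolvent_mull.
Qed.

Lemma cayley'_bound t : frob_norm (cayley' W t) <= 2 * frob_norm W.
Proof.
rewrite /cayley' frob_normN frob_normZ ger0_norm // ler_wpM2l //.
exact: resolvent_sandwich.
Qed.

Lemma resolvent_diff_mul b (N : 'M[R]_(n, b)) s t :
  frob_norm ((Y s - Y t) *m N) <= `|s - t| * (frob_norm W * frob_norm N).
Proof.
rewrite resolvent_diff // -scalemxAl frob_normZ distrC ler_wpM2l //.
rewrite -!mulmxA; apply: le_trans (resolvent_mull _ _ skew) _.
apply: le_trans (frob_normM _ _) _; rewrite ler_wpM2l ?frob_norm_ge0 //.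
exact: resolvent_mull.
Qed.

Lemma cayley_expansion t h :
  frob_norm (cayley W (h + t) - cayley W t - h *: cayley' W t) <=
  2 * frob_norm W ^+ 2 * h ^+ 2.
Proof.
have -> : cayley W (h + t) - cayley W t - h *: cayley' W t =
    - (2 * h) *: ((Y (h + t) - Y t) *m (W *m Y t)).
  rewrite mulmxBl !mulmxA.
  have -> : cayley W (h + t) - cayley W t = 2 *: (Y (h + t) - Y t).
    by rewrite /cayley; apply/matrixP => i j; rewrite !mxE; ring.
  rewrite [Y (h + t) - Y t]resolvent_diff // /cayley'.
  by apply/matrixP => i j; rewrite !mxE; ring.
rewrite frob_normZ normrN normrM (@ger0_norm _ 2) //.
have := resolvent_diff_mul (W *m Y t) (h + t) t; rewrite addrK => H1.
have H2 := ler_wpM2l (frob_norm_ge0 W) (resolvent_mulr skew W t).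
have H3 := le_trans H1 (ler_wpM2l (normr_ge0 h) H2).
apply: le_trans (ler_wpM2l _ H3) _; first by rewrite mulr_ge0.
by rewrite -[h ^+ 2]real_normK ?num_real // le_eqVlt; apply/orP; left; apply/eqP; ring.
Qed.

Lemma cayley'_lipschitz s t :
  frob_norm (cayley' W s - cayley' W t) <= 4 * frob_norm W ^+ 2 * `|s - t|.
Proof.
have -> : cayley' W s - cayley' W t =
    - 2 *: ((Y s - Y t) *m (W *m Y s) + Y t *m (W *m (Y s - Y t))).
  by rewrite mulmxBl !mulmxBr !mulmxA /cayley'; apply/matrixP => i j; rewrite !mxE; ring.
rewrite frob_normZ normrN ger0_norm //.
have H1 := le_trans (resolvent_diff_mul (W *m Y s) s t) (ler_wpM2l (normr_ge0 _)
  (ler_wpM2l (frob_norm_ge0 W) (resolvent_mulr skew W s))).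
have H2 : frob_norm (Y t *m (W *m (Y s - Y t))) <= `|s - t| * (frob_norm W * frob_norm W).
  apply: le_trans (resolvent_mull _ _ skew) _.
  rewrite resolvent_diff // -scalemxAr frob_normZ distrC ler_wpM2l // !mulmxA.
  apply: le_trans (resolvent_mulr skew _ _) _; rewrite -mulmxA.
  apply: le_trans (frob_normM _ _) _; rewrite ler_wpM2l ?frob_norm_ge0 //.
  exact: resolvent_mull.
have := le_trans (frob_normD _ _) (lerD H1 H2); lra.
Qed.

End CayleyEstimates.

(** The transform is inverted by W = (1 - P) (1 + P)^-1; for P close to 1 the
    matrix 1 + P is expansive, hence invertible with a contracting inverse. *)
Lemma cayley_generator n (P : 'M[R]_n) : orthogonal_set P -> frob_norm (1%:M - P) <= 1 ->
  exists W : 'M[R]_n, [/\ W^T = - W, cayley W 1 = P & frob_norm W <= frob_norm (1%:M - P)].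
Proof.
move=> oP hP; have oP' : P^T *m P = 1%:M by [].
have ex a (N : 'M[R]_(a, n)) : frob_norm N <= frob_norm (N *m (1%:M + P)).
  have H1 : frob_norm (N *m (1%:M - P)) <= frob_norm N.
    by apply: le_trans (frob_normM _ _) _; rewrite ler_piMr ?frob_norm_ge0.
  have -> : N *m (1%:M + P) = 2 *: N - N *m (1%:M - P).
    by rewrite mulmxDr mulmxBr mulmx1; apply/matrixP => i j; rewrite !mxE; ring.
  have := frob_normD (2 *: N - N *m (1%:M - P)) (N *m (1%:M - P)).
  rewrite subrK frob_normZ ger0_norm //; lra.
have uP : 1%:M + P \in unitmx by apply: unitmx_of_expansive => u; exact: ex.
set T := invmx (1%:M + P).
have T1 : (1%:M + P) *m T = 1%:M by rewrite mulmxV.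
have WE : 2 *: T - 1%:M = (1%:M - P) *m T.
  have -> : 1%:M - P = 2 *: 1%:M - (1%:M + P).
    by apply/matrixP => i j; rewrite !mxE; ring.
  by rewrite mulmxBl T1 -scalemxAl mul1mx.
have TT : T^T = P *m T.
  have uPT : (1%:M + P)^T \in unitmx by rewrite unitmx_tr.
  apply: (can_inj (mulKmx uPT)); rewrite -trmx_mul mulVmx // trmx1.
  by rewrite linearD /= trmx1 mulmxA mulmxDl mul1mx oP' addrC T1.
exists (2 *: T - 1%:M); split.
- rewrite linearB linearZ /= TT trmx1.
  have : T + P *m T = 1%:M by rewrite -T1 mulmxDl mul1mx.
  move=> <-; rewrite -TT; apply/matrixP => i j; rewrite !mxE; ring.
- rewrite /cayley /resolvent scale1r.
  have -> : 1%:M + (2 *: T - 1%:M) = 2 *: T by rewrite addrC subrK.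
  rewrite invmxZ ?invmxK; last by rewrite unitmxZ ?unitmx_inv ?unitfE ?pnatr_eq0.
  by rewrite scalerA mulfV ?pnatr_eq0 // scale1r addrC addKr.
- rewrite WE; apply: le_trans (ex _ _) _.
  by rewrite -mulmxA mulVmx // mulmx1.
Qed.

Lemma C1_of_quadratic_bound (V : normedModType R) (g g' : R -> V) (C : R) :
  (forall t h, `|g (h + t) - g t - h *: g' t| <= C * h ^+ 2) ->
  (forall s t, `|g' s - g' t| <= C * `|s - t|) ->
  [/\ Ck 1 [set: R] g, forall t, derive1 g t = g' t & continuous g'].
Proof.
move=> H L; have cg' : continuous g' by apply: (@continuous_of_lipschitz _ _ _ _ C).
have d (t : R) : is_derive t (1 : R) g (g' t).
  by apply: (@is_derive_of_quadratic_bound _ _ _ _ C) => h _; exact: H.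
have diff (t : R) : differentiable g t by apply/derivable1_diffP; have [] := d t.
split=> //; last by move=> t; rewrite derive1E; have [_] := d t.
split=> [t v _|v t _]; first exact: diff_derivable.
have -> : 'D_v g = fun t => v *: g' t.
  apply/funext => s; rewrite deriveE //.
  have -> : g' s = 'd g s 1 by rewrite -deriveE //; have [_ ->] := d s.
  by rewrite -linearZ /= [v *: 1]mulr1.
apply: (@continuous_of_lipschitz _ _ _ _ (`|v| * C)) => x y.
by rewrite -scalerBr normrZ -mulrA ler_wpM2l //; exact: L.
Qed.

End CayleyCurve.

Section DistanceUpperBound.
Context {R : realType} {l m p : nat}.
Local Notation V := (ambient R l m p).
Implicit Types X Y : V.

Lemma curve_length_le (g g' : R -> V) (M : R) : (forall t, derive1 g t = g' t) ->
  continuous g' -> (forall t, metric_norm (g' t) <= M) ->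
  (curve_length g <= M%:E)%E.
Proof.
move=> gE cg' hM; rewrite /curve_length.
have -> : M%:E = (\int[@lebesgue_measure R]_(t in `[0%R, 1%R]) (cst M%:E) t)%E.
  rewrite integral_cst //= lebesgue_measure_itv /= lte_fin ltr01.
  by rewrite oppr0 adde0 mule1.
apply: ge0_le_integral => //.
- by move=> t _; rewrite lee_fin metric_norm_ge0.
- apply/measurable_EFinP; apply: (@measurable_funS _ _ _ _ [set: R]) => //.
  apply: continuous_measurable_fun => t.
  have -> : (fun t => metric_norm (derive1 g t)) = (@metric_norm R l m p) \o g'.
    by apply/funext => s /=; rewrite gE.
  apply: (@continuous_comp _ _ _ g' (@metric_norm R l m p)); first exact: cg'.
  exact: metric_norm_continuous.
- by move=> t _; rewrite lee_fin gE.
Qed.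

(** Nearby points of the manifold are joined by a Cayley curve in the
    orthogonal factor and segments in the linear ones. *)
Lemma distZ_le X Y : Zset X -> Zset Y -> frob_norm (X.1.2 - Y.1.2) <= 1 ->
  (distZ X Y <= (4 * metric_norm (X - Y))%:E)%E.
Proof.
move=> [oX dX] [oY dY] h; have oX' := orthogonal_mulT oX.
have Xu : X.1.2^T *m X.1.2 = 1%:M by [].
have oP : orthogonal_set (X.1.2^T *m Y.1.2).
  rewrite /orthogonal_set /= trmx_mul trmxK mulmxA -[_ *m _ *m X.1.2^T]mulmxA.
  by rewrite oX' mulmx1.
have P1 : frob_norm (1%:M - X.1.2^T *m Y.1.2) = frob_norm (X.1.2 - Y.1.2).
  by rewrite -Xu -mulmxBr frob_norm_mulQ ?trmxK.
have hP : frob_norm (1%:M - X.1.2^T *m Y.1.2) <= 1 by rewrite P1.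
have [W [skew W1 bW]] := cayley_generator oP hP.
rewrite P1 in bW.
pose g t : V := (X.1.1 + t *: (Y.1.1 - X.1.1), X.1.2 *m cayley W t, X.2 + t *: (Y.2 - X.2)).
pose g' t : V := (Y.1.1 - X.1.1, X.1.2 *m cayley' W t, Y.2 - X.2).
have normX2 (N : 'M[R]_(m + p)) : metric_norm ((0, X.1.2 *m N, 0) : V) <= frob_norm N.
  apply: le_trans (metric_le_frob _) _.
  by rewrite /= !frob_norm0 addr0 add0r frob_norm_mulQ.
have [||C1 gE cg'] := @C1_of_quadratic_bound _ _ g g' (4 * frob_norm W ^+ 2).
- move=> t k; have -> : g (k + t) - g t - k *: g' t =
    (0, X.1.2 *m (cayley W (k + t) - cayley W t - k *: cayley' W t), 0).
    have lin (N1 N2 N3 : 'M[R]_(m + p)) : X.1.2 *m (N1 - N2 - k *: N3) =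
        X.1.2 *m N1 - X.1.2 *m N2 - k *: (X.1.2 *m N3).
      by rewrite !mulmxBr -scalemxAr.
    rewrite /g /g' lin; congr (_, _, _).
    + by apply/matrixP => i j; rewrite !mxE; ring.
    + by apply/matrixP => i j; rewrite !mxE; ring.
  apply: le_trans (norm_le_metric _) _; apply: le_trans (normX2 _) _.
  apply: le_trans (cayley_expansion skew _ _) _.
  by rewrite ler_wpM2r ?sqr_ge0 // ler_wpM2r ?sqr_ge0 // ler_nat.
- move=> s t; have -> : g' s - g' t = (0, X.1.2 *m (cayley' W s - cayley' W t), 0).
    by rewrite /g' mulmxBr; congr (_, _, _) => /=; rewrite subrr.
  apply: le_trans (norm_le_metric _) _; apply: le_trans (normX2 _) _.
  exact: cayley'_lipschitz.
apply: ge_ereal_inf; exists (curve_length g).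
  exists g => //; split.
  - exists 1%N, (fun i => i%:R); split=> // -[|//] _; split; first by rewrite ltr01.
    by exists g.
  - rewrite /g cayley0 mulmx1 !scale0r !addr0.
    by case: (X) => [[? ?] ?].
  - rewrite /g W1 mulmxA oX' mul1mx !scale1r ![_ + (_ - _)]addrC !subrK.
    by case: (Y) => [[? ?] ?].
  - move=> t _; split.
      rewrite /orthogonal_set /= trmx_mul mulmxA -[_ *m _ *m X.1.2]mulmxA Xu mulmx1.
      exact: cayley_orthogonal.
    apply/is_diag_mxP => i j ij; rewrite !mxE.
    by rewrite (is_diag_mxP dX i j ij) (is_diag_mxP dY i j ij) subrr mulr0 addr0.
apply: (curve_length_le gE cg') => t.
apply: le_trans (metric_le_frob _) _; rewrite /= frob_norm_mulQ //.
have [e1 e2 e3] := frob_le_metric (X - Y).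
have := cayley'_bound skew t.
rewrite (frob_normB Y.1.1) (frob_normB Y.2).
move: e1 e2 e3 bW => /=; lra.
Qed.

End DistanceUpperBound.

(** * Search directions *)

Section Algorithm.
Context {R : realType} {l m p : nat}.
Local Notation n := (m + p)%N.
Local Notation V := (ambient R l m p).
Variables (A0 : 'M[R]_n) (A : 'I_l -> 'M[R]_n) (lam : 'I_m -> R).
Hypothesis hA0 : A0^T = A0.
Hypothesis hA : forall i, (A i)^T = A i.
Implicit Types (X xi z : V) (S : 'M[R]_n).

Local Notation H := (Hmap A0 A lam).
Local Notation h := (hfun A0 A lam).
Local Notation DH := (DH A0 A lam).
Local Notation DHadj := (DHadj A0 A lam).
Local Notation gradh := (gradh A0 A lam).
Local Notation normal_op := (normal_op A0 A lam).
Local Notation cg_dir := (cg_dir A0 A lam).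

Let Mi := @metric_inner R l m p.
Let Fi := @frob_inner R n n.

Lemma DHD X xi xi' : DH X (xi + xi') = DH X xi + DH X xi'.
Proof. by rewrite DHE linearD. Qed.

Lemma DHZ X a xi : DH X (a *: xi) = a *: DH X xi.
Proof. by rewrite DHE linearZ. Qed.

Lemma DHB X xi xi' : DH X (xi - xi') = DH X xi - DH X xi'.
Proof. by rewrite -scaleN1r DHD DHZ scaleN1r. Qed.

Lemma DH_tangent_sym X xi : Zset X -> tangentZ X xi -> (DH X xi)^T = DH X xi.
Proof. by move=> ZX [_ d]; exact: DH_sym. Qed.

Lemma gradh_tangent X : Zset X -> tangentZ X (gradh X).
Proof. by move=> ZX; apply: DHadj_tangent => //; exact: Hmap_sym. Qed.

Lemma gradh_ip X xi : Zset X -> tangentZ X xi ->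
  metric (gradh X) xi = frob_ip (H X) (DH X xi).
Proof. by move=> ZX t; apply: DHadj_ip => //; exact: Hmap_sym. Qed.

Definition adjoint_range X : V -> Prop :=
  fun z => exists2 S, S^T = S & z = DHadj X S.

Lemma adjoint_range_tangent X z : Zset X -> adjoint_range X z -> tangentZ X z.
Proof. by move=> ZX [S sS ->]; exact: DHadj_tangent. Qed.

Section AdjointRange.
Variable X : V.
Hypothesis ZX : Zset X.

Let WD x y : adjoint_range X x -> adjoint_range X y -> adjoint_range X (x + y).
Proof.
move=> [S sS ->] [S' sS' ->]; exists (S + S'); first by rewrite linearD /= sS sS'.
by rewrite DHadjD.
Qed.

Let WZ a x : adjoint_range X x -> adjoint_range X (a *: x).
Proof.
move=> [S sS ->]; exists (a *: S); first by rewrite linearZ /= sS.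
by rewrite DHadjZ.
Qed.

Let Wb : adjoint_range X (- gradh X).
Proof. by rewrite -scaleN1r; apply: WZ; exists (H X) => //; exact: Hmap_sym. Qed.

Let WA x : adjoint_range X x -> adjoint_range X (normal_op X x).
Proof.
move=> Wx; exists (DH X x) => //; apply: DH_tangent_sym => //.
exact: adjoint_range_tangent.
Qed.

Let AD x y : adjoint_range X x -> adjoint_range X y ->
  normal_op X (x + y) = normal_op X x + normal_op X y.
Proof.
move=> Wx Wy; rewrite /Defs.normal_op DHD DHadjD //.
  by apply: DH_tangent_sym => //; exact: adjoint_range_tangent.
by apply: DH_tangent_sym => //; exact: adjoint_range_tangent.
Qed.

Let AZ a x : adjoint_range X x -> normal_op X (a *: x) = a *: normal_op X x.
Proof.
move=> Wx; rewrite /Defs.normal_op DHZ DHadjZ //.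
by apply: DH_tangent_sym => //; exact: adjoint_range_tangent.
Qed.

Lemma cg_dir_range i : adjoint_range X (cg_dir X i).
Proof. exact: (cg_iterate_sub metric WD WZ Wb WA). Qed.

Lemma normal_op_ip x y : tangentZ X x -> tangentZ X y ->
  metric (normal_op X x) y = frob_ip (DH X x) (DH X y).
Proof. by move=> tx ty; rewrite DHadj_ip //; exact: DH_tangent_sym. Qed.

(** The conjugate gradient method solves the Gauss-Newton equation exactly in
    finitely many steps, because the normal operator is positive definite on the
    range of the adjoint, even where it is singular on the tangent space. *)
Lemma cg_dir_exact : exists i, normal_op X (cg_dir X i) = - gradh X.
Proof.
have [N orth] := metric_orthogonal_bound R l m p.
apply: (cg_exact Mi WD WZ Wb WA AD AZ _ _ orth).
- move=> x y /(adjoint_range_tangent ZX) tx /(adjoint_range_tangent ZX) ty.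
  by rewrite (ipC Mi x) !normal_op_ip // (ipC Fi).
- move=> x Wx; have tx := adjoint_range_tangent ZX Wx.
  rewrite (ipC Mi) normal_op_ip // => /(ip_eq0 Fi) Dx0.
  have [S sS xS] := Wx; apply: (ip_eq0 Mi).
  by rewrite {1}xS DHadj_ip // Dx0 (ip0r Fi).
Qed.

End AdjointRange.

Variable etamax : R.
Hypothesis hetamax : 0 < etamax < 1.
Local Notation eta := (eta A0 A lam etamax).
Local Notation acceptable := (acceptable A0 A lam etamax).
Local Notation search_direction := (search_direction A0 A lam etamax).

Lemma eta_ge0 X : 0 <= eta X.
Proof. by rewrite le_min metric_norm_ge0 andbT ltW //; case/andP: hetamax. Qed.

Lemma search_direction_tangent X d : Zset X -> search_direction X d -> tangentZ X d.
Proof.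
move=> ZX [[i -> _]|[_ ->]].
  by apply: adjoint_range_tangent => //; exact: cg_dir_range.
by rewrite -scaleN1r; apply: tangentZZ; exact: gradh_tangent.
Qed.

(** Both kinds of directions are gradient related with the same constant. *)
Lemma search_direction_descent X d (e : R) : e <= eta X -> e <= 1 ->
  search_direction X d -> metric (gradh X) d <= - e * metric_norm d ^+ 2.
Proof.
move=> eX e1 [[i _ [_ hd]]|[_ ->]].
  apply: le_trans hd _; rewrite metric_norm_sqr !mulNr lerN2.
  by rewrite ler_wpM2r // (ip_ge0 Mi).
rewrite metric_norm_sqr (ipNl Mi) !(ipNr Mi) opprK mulNr lerN2.
by rewrite ler_piMl ?(ip_ge0 Mi).
Qed.

(** Estimates valid around a point at which the differential is surjective. *)
Record local_model (Ro : 'M[R]_n -> 'M[R]_n -> 'M[R]_n) (Xs : V)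
    (r K kappa L : R) : Prop := {
  lm_r : 0 < r <= 1 ;
  lm_K : 1 <= K ;
  lm_kappa : 0 < kappa ;
  lm_L : 0 <= L ;
  lm_DH : forall X xi, Zset X -> metric_norm (X - Xs) <= r ->
    frob_norm (DH X xi) <= K * metric_norm xi ;
  lm_DHadj : forall X S, Zset X -> metric_norm (X - Xs) <= r -> S^T = S ->
    kappa * frob_norm S <= metric_norm (DHadj X S) ;
  lm_H : forall X, Zset X -> metric_norm (X - Xs) <= r ->
    frob_norm (H X - H Xs) <= K * metric_norm (X - Xs) ;
  lm_retract : forall X xi, Zset X -> metric_norm (X - Xs) <= r ->
    tangentZ X xi -> metric_norm xi <= r ->
    metric_norm (retractZ Ro X xi - X) <= 2 * metric_norm xi ;
  lm_taylor : forall X xi, Zset X -> metric_norm (X - Xs) <= r ->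
    tangentZ X xi -> metric_norm xi <= r ->
    frob_norm (H (retractZ Ro X xi) - H X - DH X xi) <= L * metric_norm xi ^+ 2 }.

(** The radius keeps the coefficients of H at X bounded and makes the retraction
    error smaller than xi itself. *)
Lemma local_model_exists Ro Xs : is_retraction_orthogonal Ro -> Zset Xs ->
  DH_surjective A0 A lam Xs -> exists r K kappa L, local_model Ro Xs r K kappa L.
Proof.
move=> hRo Zs surj.
have [r1 [kappa [r10 kappa0 Hk]]] := DHadj_lower_bound Zs surj.
have [r2 [L0 [r20 L00 HR]]] := retraction_quadratic hRo Zs.1.
pose sA := \sum_i frob_norm (A i).
have sA0 : 0 <= sA by apply: sumr_ge0 => i _; exact: frob_norm_ge0.
pose M := 2 + sA + frob_norm Xs.1.2 + frob_norm (spectrum_mx lam Xs.2).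
have hb := frob_norm_ge0 (spectrum_mx lam Xs.2); have hq := frob_norm_ge0 Xs.1.2.
have M1 : 1 <= M by rewrite /M; lra.
have hAM : \sum_i frob_norm (A i) <= M by rewrite /M -/sA; lra.
have bnd X : metric_norm (X - Xs) <= 1 ->
    frob_norm X.1.2 <= M /\ frob_norm (spectrum_mx lam X.2) <= M.
  move=> d1; have [_ eQ eL] := frob_le_metric (X - Xs); split.
    rewrite -(subrK Xs.1.2 X.1.2); apply: le_trans (frob_normD _ _) _.
    by move: eQ => /=; rewrite /M; lra.
  rewrite -(subrK Xs.2 X.2) addrC spectrum_mxD; apply: le_trans (frob_normD _ _) _.
  by rewrite frob_lower_block; move: eL => /=; rewrite /M; lra.
have M2 : M <= M ^+ 2 by rewrite expr2 ler_peMl // (le_trans ler01).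
pose r := Num.min (Num.min 1 r1) (Num.min (r2 / 2) (L0 + 1)^-1).
have r0 : 0 < r by rewrite !lt_min ltr01 r10 divr_gt0 // invr_gt0 ltr_wpDl.
have : r <= r by []; rewrite {2}/r !le_min => /andP[/andP[rle1 rler1] /andP[rler2 rleL]].
have DHb X xi : metric_norm (X - Xs) <= 1 ->
    frob_norm (DH X xi) <= 8 * M ^+ 2 * metric_norm xi.
  move=> d1; have [hQ hB] := bnd X d1; rewrite DHE.
  apply: le_trans (differential_bound xi M1 hAM hQ hB) _.
  by rewrite ler_wpM2r ?metric_norm_ge0 // ler_wpM2r ?sqr_ge0 // ler_nat.
have err X xi : Zset X -> metric_norm (X - Xs) <= r -> tangentZ X xi -> metric_norm xi <= r ->
    metric_norm (retractZ Ro X xi - X - xi) <= L0 * metric_norm xi ^+ 2.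
  move=> ZX dX [tx _] xr.
  have [_ eQ _] := frob_le_metric (X - Xs); have [_ xQ _] := frob_le_metric xi.
  apply: le_trans (metric_le_frob _) _.
  rewrite /retractZ /= [X.1.1 + _ - X.1.1]addrAC [X.2 + _ - X.2]addrAC !subrr !add0r !subrr.
  rewrite !frob_norm0 add0r addr0.
  apply: le_trans (HR _ _ ZX.1 tx _ _) _; [| |by rewrite ler_wpM2l // ler_pXn2r ?nnegrE ?frob_norm_ge0 ?metric_norm_ge0].
    by move: eQ => /=; lra.
  by lra.
have mv X xi : Zset X -> metric_norm (X - Xs) <= r -> tangentZ X xi -> metric_norm xi <= r ->
    metric_norm (retractZ Ro X xi - X) <= 2 * metric_norm xi.
  move=> ZX dX tx xr; rewrite -(subrK xi (retractZ Ro X xi - X)).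
  apply: le_trans (metric_normD _ _) _.
  have e := err X xi ZX dX tx xr; have x0 := metric_norm_ge0 xi.
  have : (L0 + 1) * metric_norm xi <= 1.
    by rewrite mulrC -ler_pdivlMr ?ltr_wpDl // mul1r (le_trans xr).
  move=> e1; have := ler_wpM2r x0 e1; rewrite mul1r -mulrA -expr2 mulrDl mul1r.
  by have := sqr_ge0 (metric_norm xi); lra.
exists r, (8 * M ^+ 2), kappa, ((3 * M + 2) * 4 + 8 * M ^+ 2 * L0); split => //.
- by rewrite r0 rle1.
- by lra.
- by rewrite addr_ge0 // mulr_ge0 // ?mulr_ge0 ?sqr_ge0 //; lra.
- by move=> X xi _ dX; apply: DHb; apply: le_trans dX rle1.
- by move=> X S ZX dX; apply: Hk => //; apply: le_trans dX rler1.
- move=> X ZX dX; have d1 := le_trans dX rle1.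
  have M0 : frob_norm Xs.1.2 <= M /\ frob_norm (spectrum_mx lam Xs.2) <= M.
    by rewrite /M; split; lra.
  have := @Hmap_taylor R l m p A0 A lam Xs (X - Xs) M M0.1 M0.2.
  rewrite [Xs + _]addrC subrK => e.
  rewrite -(subrK (differential A lam Xs (X - Xs)) (H X - H Xs)).
  apply: le_trans (frob_normD _ _) _.
  have e2 := differential_bound (X - Xs) M1 hAM M0.1 M0.2.
  have d0 := metric_norm_ge0 (X - Xs).
  have : metric_norm (X - Xs) ^+ 2 <= metric_norm (X - Xs).
    by rewrite expr2 ler_piMl.
  move=> e3; apply: le_trans (lerD e e2) _.
  have h1 : (3 * M + metric_norm (X - Xs)) * metric_norm (X - Xs) ^+ 2 <= (3 * M + 1) * metric_norm (X - Xs).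
    by rewrite ler_pM ?sqr_ge0 //; lra.
  have h2 : (3 * M + 1) * metric_norm (X - Xs) <= 4 * M ^+ 2 * metric_norm (X - Xs).
    by rewrite ler_wpM2r //; lra.
  lra.
- move=> X xi ZX dX tx xr; have d1 := le_trans dX rle1.
  have e := err X xi ZX dX tx xr; have e' := mv X xi ZX dX tx xr.
  have [hQ hB] := bnd X d1; have x0 := metric_norm_ge0 xi.
  have := @Hmap_taylor R l m p A0 A lam X (retractZ Ro X xi - X) M hQ hB.
  rewrite [X + _]addrC subrK -(DHE A0) => e1.
  rewrite -(subrK (DH X (retractZ Ro X xi - X)) (_ - H X)) -addrA -DHB.
  apply: le_trans (frob_normD _ _) _; rewrite mulrDl lerD //.
    apply: le_trans e1 _; rewrite -mulrA ler_pM ?sqr_ge0 ?addr_ge0 ?metric_norm_ge0 //; try lra.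
    have -> : 4 * metric_norm xi ^+ 2 = (2 * metric_norm xi) ^+ 2 by ring.
    by rewrite ler_pXn2r ?nnegrE ?metric_norm_ge0 ?mulr_ge0.
  have := DHb X (retractZ Ro X xi - X - xi) d1; move=> e2; apply: le_trans e2 _.
  rewrite -(mulrA (8 * M ^+ 2) L0); apply: ler_wpM2l e.
  by rewrite mulr_ge0 ?sqr_ge0.
Qed.

End Algorithm.

(** * Convergence of the method *)

Section Convergence.
Context {R : realType} {l m p : nat}.
Local Notation n := (m + p)%N.
Local Notation V := (ambient R l m p).
Variables (A0 : 'M[R]_n) (A : 'I_l -> 'M[R]_n) (lam : 'I_m -> R).
Hypothesis hA0 : A0^T = A0.
Hypothesis hA : forall i, (A i)^T = A i.
Variables (Ro : 'M[R]_n -> 'M[R]_n -> 'M[R]_n) (beta etamax sigma : R).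
Hypothesis hRo : is_retraction_orthogonal Ro.
Hypothesis hbeta : 0 < beta < 1.
Hypothesis hetamax : 0 < etamax < 1.
Hypothesis hsigma : 0 < sigma < 2^-1.

Local Notation H := (Hmap A0 A lam).
Local Notation h := (hfun A0 A lam).
Local Notation DH := (DH A0 A lam).
Local Notation DHadj := (DHadj A0 A lam).
Local Notation gradh := (gradh A0 A lam).
Local Notation normal_op := (normal_op A0 A lam).
Local Notation eta := (eta A0 A lam etamax).
Local Notation search_direction := (search_direction A0 A lam etamax).
Local Notation armijo := (armijo A0 A lam Ro beta sigma).

Let Mi := @metric_inner R l m p.
Let Fi := @frob_inner R n n.
Implicit Types (X xi : V) (S : 'M[R]_n).

Lemma retractZ_range X xi : Zset X -> tangentZ X xi -> Zset (retractZ Ro X xi).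
Proof.
move=> [oQ dX] [tx dxi]; split; first exact: (retraction_range hRo).
apply/is_diag_mxP => i j ij; rewrite mxE.
by rewrite (is_diag_mxP dX i j ij) (is_diag_mxP dxi i j ij) addr0.
Qed.

Section Local.
Variables (Xs : V) (r K kappa L : R).
Hypothesis model : local_model A0 A lam Ro Xs r K kappa L.

Let K0 : 0 < K. Proof. exact: lt_le_trans ltr01 (lm_K model). Qed.
Let kappa0 : 0 < kappa. Proof. exact: lm_kappa model. Qed.
Let L0 : 0 <= L. Proof. exact: lm_L model. Qed.
Let r0 : 0 < r. Proof. by have /andP[] := lm_r model. Qed.
Let r1 : r <= 1. Proof. by have /andP[] := lm_r model. Qed.

Section AtPoint.
Variable X : V.
Hypothesis ZX : Zset X.
Hypothesis dX : metric_norm (X - Xs) <= r.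

Let sH : (H X)^T = H X. Proof. exact: Hmap_sym. Qed.

Lemma DHadj_upper S : S^T = S -> metric_norm (DHadj X S) <= K * frob_norm S.
Proof.
move=> sS; have t := DHadj_tangent A0 A lam ZX sS.
have [e|n0] := eqVneq (metric_norm (DHadj X S)) 0.
  by rewrite e mulr_ge0 ?frob_norm_ge0 // ltW.
have p0 : 0 < metric_norm (DHadj X S) by rewrite lt_def n0 metric_norm_ge0.
rewrite -(ler_pM2l p0) -expr2 metric_norm_sqr DHadj_ip //.
apply: le_trans (frob_ip_le _ _) _.
apply: le_trans (ler_wpM2l (frob_norm_ge0 S) (lm_DH model (DHadj X S) ZX dX)) _.
by rewrite le_eqVlt; apply/orP; left; apply/eqP; ring.
Qed.

Lemma gradh_upper : metric_norm (gradh X) <= K * frob_norm (H X).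
Proof. exact: DHadj_upper. Qed.

Lemma hfun_quadratic xi : tangentZ X xi -> metric_norm xi <= r ->
  h (retractZ Ro X xi) - h X <= metric (gradh X) xi +
    (L * frob_norm (H X) + (K + L) ^+ 2) * metric_norm xi ^+ 2.
Proof.
move=> t xr; have T := lm_taylor model ZX dX t xr.
have D := lm_DH model (xi) ZX dX.
set H' := H (retractZ Ro X xi) in T *.
set d := H' - H X - DH X xi in T.
have x0 := metric_norm_ge0 xi; have x1 := le_trans xr r1.
have Hd : H' = H X + (DH X xi + d) by rewrite /d [DH X xi + _]addrC subrK addrC subrK.
have b2 : frob_norm (DH X xi + d) <= (K + L) * metric_norm xi.
  apply: le_trans (frob_normD _ _) _; rewrite mulrDl lerD //.
  by apply: le_trans T _; rewrite ler_wpM2l // expr2 ler_piMl.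
have b3 : frob_norm (DH X xi + d) ^+ 2 <= (K + L) ^+ 2 * metric_norm xi ^+ 2.
  by rewrite -exprMn ler_pXn2r ?nnegrE ?frob_norm_ge0 // mulr_ge0 // addr_ge0 // ltW.
have b4 : frob_ip (H X) d <= L * frob_norm (H X) * metric_norm xi ^+ 2.
  apply: le_trans (frob_ip_le _ _) _.
  apply: le_trans (ler_wpM2l (frob_norm_ge0 _) T) _.
  by rewrite le_eqVlt; apply/orP; left; apply/eqP; ring.
have e : frob_norm H' ^+ 2 = frob_norm (H X) ^+ 2 + 2 * metric (gradh X) xi +
    2 * frob_ip (H X) d + frob_norm (DH X xi + d) ^+ 2.
  by rewrite gradh_ip // Hd frob_norm_sqrD (ipDr Fi (DH X xi) d (H X)); ring.
have := sqr_ge0 (metric_norm xi); have := sqr_ge0 (K + L).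
by rewrite /h -/H' e; nra.
Qed.

End AtPoint.

(** Away from zero residuals every iteration near Xs decreases h by a fixed
    amount: the gradient is bounded below, so are the search directions, and
    backtracking stops after boundedly many trials. *)
Lemma uniform_decrease (eps : R) : Zset Xs -> 0 < eps -> frob_norm (H Xs) = 2 * eps ->
  exists rho theta : R, [/\ 0 < rho, 0 < theta & forall X d lk, Zset X ->
    metric_norm (X - Xs) <= rho -> search_direction X d -> armijo X d lk ->
    (forall j, (j < lk)%N -> ~ armijo X d j) ->
    h (retractZ Ro X (beta ^+ lk *: d)) <= h X - theta].
Proof.
move=> Zs eps0 Hs; have [b0 b1] := andP hbeta; have [em0 em1] := andP hetamax.
have [s0 s1] := andP hsigma; have K1 := lm_K model.
pose gam := kappa * eps; have gam0 : 0 < gam by rewrite mulr_gt0.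
pose e0 := Num.min etamax gam.
have e00 : 0 < e0 by rewrite lt_min em0.
have e01 : e0 <= 1 by rewrite ge_min (ltW em1).
pose D := K * (3 * eps) / e0; have D0 : 0 < D by rewrite divr_gt0 // !mulr_gt0.
pose C := L * (3 * eps) + (K + L) ^+ 2.
have C0 : 0 < C by rewrite ltr_wpDl ?exprn_gt0 ?ltr_wpDr // !mulr_ge0 // ltW.
pose tau := Num.min (r / D) ((1 - sigma) * e0 / C).
have tau0 : 0 < tau by rewrite lt_min divr_gt0 // divr_gt0 // mulr_gt0 //; lra.
have [J bJ] : exists J, beta ^+ J <= tau.
  have : beta ^+ k @[k --> \oo] --> 0 by apply: cvg_expr; rewrite ger0_norm // ltW.
  move=> /cvgrPdist_le/(_ _ tau0)[J _ HJ]; exists J.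
  by have := HJ J (leqnn J); rewrite /= sub0r normrN ger0_norm // exprn_ge0 // ltW.
pose d0 := (1 - etamax) * gam / K ^+ 2.
have d00 : 0 < d0 by rewrite divr_gt0 ?exprn_gt0 // mulr_gt0 // subr_gt0.
exists (Num.min r (eps / K)), (sigma * beta ^+ J * (e0 * d0 ^+ 2)); split.
- by rewrite lt_min r0 divr_gt0.
- by apply: mulr_gt0; [apply: mulr_gt0 => //|apply: mulr_gt0 => //]; exact: exprn_gt0.
move=> X d lk ZX; rewrite le_min => /andP[dX dXe] sd ar arN.
have sH : (H X)^T = H X by exact: Hmap_sym.
have td := search_direction_tangent hA0 hA ZX sd.
rewrite ler_pdivlMr // mulrC in dXe.
have HX := le_trans (lm_H model ZX dX) dXe.
have Hlo : eps <= frob_norm (H X).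
  have := frob_normD (H X) (H Xs - H X); rewrite [H X + _]addrC subrK frob_normB Hs; lra.
have Hup : frob_norm (H X) <= 3 * eps.
  have := frob_normD (H X - H Xs) (H Xs); rewrite subrK Hs; lra.
have glo : gam <= metric_norm (gradh X).
  by apply: le_trans (lm_DHadj model ZX dX sH); rewrite ler_wpM2l // ltW.
have gup : metric_norm (gradh X) <= K * (3 * eps).
  by apply: le_trans (gradh_upper ZX dX) _; rewrite ler_wpM2l // ltW.
have e0X : e0 <= eta X.
  by rewrite /eta le_min !ge_min lexx /= glo orbT.
have desc := search_direction_descent e0X e01 sd.
have dn0 := metric_norm_ge0 d.
have dup : metric_norm d <= D.
  rewrite /D ler_pdivlMr //.
  have [->|dn] := eqVneq (metric_norm d) 0; first by rewrite mul0r !mulr_ge0 // ltW.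
  have dp : 0 < metric_norm d by rewrite lt_def dn.
  rewrite -(ler_pM2l dp).
  have := metric_le (- gradh X) d; rewrite (ipNl Mi).
  rewrite metric_normN => cs; have := ler_wpM2r dn0 gup; lra.
have dlo : d0 <= metric_norm d.
  rewrite /d0 ler_pdivrMr ?exprn_gt0 //.
  have K21 : metric_norm d <= metric_norm d * K ^+ 2.
    by rewrite ler_peMr // exprn_ege1.
  have [[i _ [res _]]|[_ dE]] := sd; last first.
    apply: le_trans K21; rewrite dE metric_normN.
    apply: le_trans glo; rewrite ler_piMl ?ltW //; lra.
  have eX : eta X <= etamax by rewrite /eta ge_min lexx.
  have nd : metric_norm (normal_op X d) <= K ^+ 2 * metric_norm d.
    apply: le_trans (DHadj_upper ZX dX (DH_tangent_sym A0 lam hA ZX td)) _.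
    by rewrite expr2 -mulrA ler_wpM2l ?(lm_DH model) // ltW.
  have := metric_norm_sub (normal_op X d + gradh X) (normal_op X d).
  rewrite addrAC subrr add0r => g1.
  have g2 := le_trans res (ler_wpM2r (metric_norm_ge0 _) eX).
  have : (1 - etamax) * gam <= (1 - etamax) * metric_norm (gradh X).
    by rewrite ler_wpM2l // subr_ge0 ltW.
  move: g1 g2 nd; rewrite -/(gradh X); lra.
have arJ : armijo X d J.
  rewrite /armijo; have bJ0 : 0 < beta ^+ J by rewrite exprn_gt0.
  move: bJ; rewrite le_min => /andP[bJ1 bJ2].
  have tJ : tangentZ X (beta ^+ J *: d) by exact: tangentZZ.
  have nJ : metric_norm (beta ^+ J *: d) = beta ^+ J * metric_norm d.
    by rewrite metric_normZ gtr0_norm.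
  have rJ : metric_norm (beta ^+ J *: d) <= r.
    rewrite ler_pdivlMr // in bJ1; rewrite nJ; apply: le_trans bJ1.
    by rewrite ler_wpM2l // ltW.
  apply: le_trans (hfun_quadratic ZX dX tJ rJ) _.
  rewrite (ipZr Mi) nJ exprMn.
  have cC : L * frob_norm (H X) + (K + L) ^+ 2 <= C by rewrite lerD2r ler_wpM2l.
  rewrite ler_pdivlMr // in bJ2.
  have n2 := sqr_ge0 (metric_norm d).
  have h1 : (L * frob_norm (H X) + (K + L) ^+ 2) * (beta ^+ J ^+ 2 * metric_norm d ^+ 2) <=
      C * (beta ^+ J ^+ 2 * metric_norm d ^+ 2).
    by rewrite ler_wpM2r // mulr_ge0 ?sqr_ge0.
  have h2 : beta ^+ J * C * (beta ^+ J * metric_norm d ^+ 2) <=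
      (1 - sigma) * e0 * (beta ^+ J * metric_norm d ^+ 2).
    by rewrite ler_wpM2r // mulr_ge0 // ltW.
  have h3 : (1 - sigma) * beta ^+ J * metric (gradh X) d <=
      (1 - sigma) * beta ^+ J * (- e0 * metric_norm d ^+ 2).
    by rewrite ler_wpM2l // mulr_ge0 ?subr_ge0 ?ltW //; lra.
  lra.
have lkJ : (lk <= J)%N by rewrite leqNgt; apply/negP => /arN.
have blk : beta ^+ J <= beta ^+ lk by rewrite ler_wiXn2l // ltW.
have h1 : e0 * d0 ^+ 2 <= - metric (gradh X) d.
  have : e0 * d0 ^+ 2 <= e0 * metric_norm d ^+ 2.
    apply: ler_wpM2l; first exact: ltW.
    by rewrite ler_pXn2r ?nnegrE // ltW.
  lra.
have h2 : sigma * beta ^+ J * (e0 * d0 ^+ 2) <= sigma * beta ^+ lk * (- metric (gradh X) d).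
  have se : 0 <= sigma * beta ^+ J by rewrite mulr_ge0 ?exprn_ge0 // ltW.
  have ed : 0 <= e0 * d0 ^+ 2 by rewrite mulr_ge0 ?sqr_ge0 // ltW.
  by apply: ler_pM => //; rewrite ler_wpM2l // ltW.
by move: ar; rewrite /armijo; lra.
Qed.

Section NewtonStep.
Variable X : V.
Hypothesis ZX : Zset X.
Hypothesis dX : metric_norm (X - Xs) <= r.

Let sH : (H X)^T = H X. Proof. exact: Hmap_sym. Qed.

(** On the range of the adjoint DH is bounded below, since there z = DHadj X S
    gives |z|^2 = <S, DH z> with |S| <= |z| / kappa. *)
Lemma adjoint_range_bound z : adjoint_range A0 A lam X z ->
  kappa * metric_norm z <= frob_norm (DH X z).
Proof.
move=> Wz; have tz := adjoint_range_tangent ZX Wz; have [S sS zS] := Wz.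
have [->|n0] := eqVneq (metric_norm z) 0; first by rewrite mulr0 frob_norm_ge0.
have p0 : 0 < metric_norm z by rewrite lt_def n0 metric_norm_ge0.
have lo := lm_DHadj model ZX dX sS; rewrite -zS in lo.
rewrite -(ler_pM2l p0) mulrCA -expr2 metric_norm_sqr {1}zS DHadj_ip //.
apply: le_trans (ler_wpM2l (ltW kappa0) (frob_ip_le _ _)) _.
by rewrite mulrA ler_wpM2r ?frob_norm_ge0.
Qed.

Lemma normal_residual z : tangentZ X z ->
  kappa * frob_norm (DH X z + H X) <= metric_norm (normal_op X z + gradh X).
Proof.
move=> tz; have sD := DH_tangent_sym A0 lam hA ZX tz.
have -> : normal_op X z + gradh X = DHadj X (DH X z + H X).
  by rewrite (DHadjD A0 A lam ZX sD sH).
by apply: (lm_DHadj model ZX dX); rewrite linearD /= sD sH.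
Qed.

(** Close to a solution the exact Gauss-Newton direction satisfies both
    acceptance tests, so the conjugate gradient phase never fails. *)
Lemma exact_direction_acceptable : K * frob_norm (H X) <= kappa ^+ 2 ->
  exists i, acceptable A0 A lam etamax X (cg_dir A0 A lam X i).
Proof.
move=> small; have [i hi] := cg_dir_exact lam hA0 hA ZX; exists i.
set x := cg_dir A0 A lam X i in hi *.
have Wx : adjoint_range A0 A lam X x by exact: cg_dir_range.
have tx := adjoint_range_tangent ZX Wx.
have Dx : DH X x = - H X.
  have := normal_residual tx; rewrite hi addNr metric_norm0 => e.
  apply/eqP; rewrite -addr_eq0; apply/eqP; apply: frob_norm_eq0.
  apply/eqP; rewrite eq_le frob_norm_ge0 andbT.
  by rewrite -(ler_pM2l kappa0) mulr0.
have bx := adjoint_range_bound Wx; rewrite Dx frob_normN in bx.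
split.
  rewrite hi -/(gradh X) addNr metric_norm0.
  by rewrite mulr_ge0 ?metric_norm_ge0 // eta_ge0.
rewrite gradh_ip // Dx (ipNr Fi) -frob_norm_sqr mulNr lerN2 -metric_norm_sqr.
have k2 : 0 < kappa ^+ 2 by exact: exprn_gt0.
rewrite -(ler_pM2l k2).
have e1 : eta X <= kappa ^+ 2.
  apply: le_trans small; apply: le_trans (gradh_upper ZX dX).
  by rewrite /eta ge_min lexx orbT.
have bx2 : kappa ^+ 2 * metric_norm x ^+ 2 <= frob_norm (H X) ^+ 2.
  rewrite -exprMn ler_pXn2r ?nnegrE ?frob_norm_ge0 //.
  by rewrite mulr_ge0 ?metric_norm_ge0 // ltW.
rewrite mulrCA; apply: ler_pM => //; first exact: eta_ge0.
by rewrite mulr_ge0 ?sqr_ge0.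
Qed.

Lemma accepted_direction d : K * frob_norm (H X) <= kappa ^+ 2 ->
  K ^+ 2 / kappa * frob_norm (H X) <= 1 -> search_direction X d ->
  [/\ frob_norm (DH X d + H X) <= K ^+ 2 / kappa * frob_norm (H X) ^+ 2 &
      metric_norm d <= 2 / kappa * frob_norm (H X)].
Proof.
move=> small small2 sd; have td := search_direction_tangent hA0 hA ZX sd.
have [[i dE [res _]]|[N _]] := sd; last first.
  by have [i /(N i)] := exact_direction_acceptable small.
have Wd : adjoint_range A0 A lam X d by rewrite dE; exact: cg_dir_range.
have a0 := frob_norm_ge0 (H X); have g0 := metric_norm_ge0 (gradh X).
have gK := gradh_upper ZX dX.
have e1 : frob_norm (DH X d + H X) <= K ^+ 2 / kappa * frob_norm (H X) ^+ 2.
  rewrite mulrAC ler_pdivlMr // mulrC.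
  apply: le_trans (normal_residual td) _; apply: le_trans res _.
  rewrite -exprMn expr2; apply: ler_pM => //; first exact: eta_ge0.
  by apply: le_trans gK; rewrite /eta ge_min lexx orbT.
split=> //; rewrite mulrAC ler_pdivlMr // mulrC.
apply: le_trans (adjoint_range_bound Wd) _.
have -> : DH X d = (DH X d + H X) - H X by rewrite addrK.
apply: le_trans (frob_norm_sub _ _) _.
have : K ^+ 2 / kappa * frob_norm (H X) ^+ 2 <= frob_norm (H X).
  by rewrite [frob_norm _ ^+ 2]expr2 mulrA ler_piMl.
lra.
Qed.

(** The unit step passes the line search: the linearized residual vanishes to
    second order, and sigma < 1/2 leaves room for the remainder. *)
Lemma unit_step d (C3 : R) : search_direction X d ->
  C3 = K ^+ 2 / kappa + L * (2 / kappa) ^+ 2 ->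
  frob_norm (H X) <= 1 -> K * frob_norm (H X) <= kappa ^+ 2 ->
  K ^+ 2 / kappa * frob_norm (H X) <= 1 -> 2 / kappa * frob_norm (H X) <= r ->
  (C3 ^+ 2 + K ^+ 2 / kappa) * frob_norm (H X) <= 2^-1 - sigma ->
  [/\ armijo X d 0, frob_norm (H (retractZ Ro X d)) <= C3 * frob_norm (H X) ^+ 2 &
      metric_norm (retractZ Ro X d - X) <= 4 / kappa * frob_norm (H X)].
Proof.
move=> sd C3E h1 h2 h3 h4 h5; have td := search_direction_tangent hA0 hA ZX sd.
have [res dn] := accepted_direction h2 h3 sd.
have [s0 s1] := andP hsigma.
have dr := le_trans dn h4; set a := frob_norm (H X) in h1 h2 h3 h4 h5 res dn *.
have a0 : 0 <= a by exact: frob_norm_ge0.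
have T := lm_taylor model ZX dX td dr.
have d2 : metric_norm d ^+ 2 <= (2 / kappa) ^+ 2 * a ^+ 2.
  rewrite -exprMn ler_pXn2r ?nnegrE ?metric_norm_ge0 //.
  by rewrite mulr_ge0 // divr_ge0 // ltW.
set H' := H (retractZ Ro X d) in T *.
have HH : frob_norm H' <= C3 * a ^+ 2.
  have -> : H' = (H' - H X - DH X d) + (DH X d + H X).
    by rewrite addrA subrK subrK.
  apply: le_trans (frob_normD _ _) _; rewrite C3E mulrDl addrC lerD //.
  by apply: le_trans T _; rewrite -mulrA ler_wpM2l.
split=> //; last first.
  apply: le_trans (lm_retract model ZX dX td dr) _.
  by have := dn; lra.
have C30 : 0 <= C3.
  by rewrite C3E addr_ge0 ?mulr_ge0 ?sqr_ge0 ?invr_ge0 // ltW.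
have c20 : 0 <= K ^+ 2 / kappa by rewrite mulr_ge0 ?sqr_ge0 ?invr_ge0 // ltW.
rewrite /armijo expr0 scale1r mulr1 /h -/H' -/a gradh_ip //.
have ipb : - a ^+ 2 - K ^+ 2 / kappa * a ^+ 3 <= frob_ip (H X) (DH X d).
  have -> : DH X d = (DH X d + H X) - H X by rewrite addrK.
  rewrite (ipBr Fi (DH X d + H X) (H X) (H X)) -frob_norm_sqr -/a.
  have := frob_ip_le (H X) (- (DH X d + H X)); rewrite (ipNr Fi) frob_normN -/a.
  have := ler_wpM2l a0 res; lra.
have hh : frob_norm H' ^+ 2 <= C3 ^+ 2 * a ^+ 3.
  have : frob_norm H' ^+ 2 <= (C3 * a ^+ 2) ^+ 2.
    by rewrite ler_pXn2r ?nnegrE ?frob_norm_ge0 // mulr_ge0 ?sqr_ge0.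
  move=> e; apply: le_trans e _; rewrite exprMn -exprM ler_wpM2l ?sqr_ge0 //.
  have -> : a ^+ (2 * 2) = a * a ^+ 3 by rewrite -exprS.
  by rewrite ler_piMl ?exprn_ge0.
have i1 := ler_wpM2l (ltW s0) ipb.
have a3 : 0 <= a ^+ 3 by exact: exprn_ge0.
have i2 := ler_wpM2r (sqr_ge0 a) h5.
have i3 : sigma * (K ^+ 2 / kappa * a ^+ 3) <= K ^+ 2 / kappa * a ^+ 3.
  by apply: ler_piMl; [exact: mulr_ge0|lra].
have i4 : 0 <= C3 ^+ 2 * a ^+ 3 by rewrite mulr_ge0 ?sqr_ge0.
have e3 : (C3 ^+ 2 + K ^+ 2 / kappa) * a * a ^+ 2 =
   C3 ^+ 2 * a ^+ 3 + K ^+ 2 / kappa * a ^+ 3 by ring.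
rewrite e3 in i2; lra.
Qed.

End NewtonStep.

(** The radius is chosen so that |H X| is small enough for all the smallness
    conditions of [unit_step] at once; b adds up the inverses of their thresholds. *)
Lemma quadratic_step : Zset Xs -> H Xs = 0 ->
  exists rho C3 C4 : R, [/\ 0 < rho <= r, 0 < C3, 0 < C4 & forall X d lk, Zset X ->
    metric_norm (X - Xs) <= rho -> search_direction X d ->
    (forall j, (j < lk)%N -> ~ armijo X d j) ->
    [/\ C3 * frob_norm (H X) <= 2^-1,
        frob_norm (H (retractZ Ro X (beta ^+ lk *: d))) <= C3 * frob_norm (H X) ^+ 2 &
        metric_norm (retractZ Ro X (beta ^+ lk *: d) - X) <= C4 * frob_norm (H X)]].
Proof.
move=> Zs Hs; have [s0 s1] := andP hsigma.
pose c2 := K ^+ 2 / kappa; have c20 : 0 < c2 by rewrite divr_gt0 ?exprn_gt0.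
pose C3 := c2 + L * (2 / kappa) ^+ 2.
have C30 : 0 < C3 by rewrite ltr_wpDr // mulr_ge0 ?sqr_ge0.
pose b := 1 + K / kappa ^+ 2 + c2 + 2 / kappa / r + (C3 ^+ 2 + c2) / (2^-1 - sigma) + 2 * C3.
have s2 : 0 < 2^-1 - sigma by rewrite subr_gt0.
have t1 : 0 < K / kappa ^+ 2 by rewrite divr_gt0 ?exprn_gt0.
have t2 : 0 < 2 / kappa / r by rewrite !divr_gt0.
have t3 : 0 < (C3 ^+ 2 + c2) / (2^-1 - sigma) by rewrite divr_gt0 // addr_gt0 ?exprn_gt0.
have b0 : 0 < b by rewrite /b; lra.
exists (Num.min r (b^-1 / K)), C3, (4 / kappa); split=> //.
- by rewrite lt_min r0 divr_gt0 ?invr_gt0 //= ge_min lexx.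
- by rewrite divr_gt0.
move=> X d lk ZX; rewrite le_min => /andP[dX dXb] sd arN.
have aK : frob_norm (H X) <= K * metric_norm (X - Xs).
  by have := lm_H model ZX dX; rewrite Hs subr0.
have ab : b * frob_norm (H X) <= 1.
  rewrite mulrC -ler_pdivlMr // mul1r; apply: le_trans aK _.
  by rewrite mulrC -ler_pdivlMr.
have a0 := frob_norm_ge0 (H X).
have le_b c : 0 <= c -> c <= b -> c * frob_norm (H X) <= 1.
  by move=> c0 cb; apply: le_trans ab; rewrite ler_wpM2r.
have h1 : frob_norm (H X) <= 1 by have := le_b 1; rewrite mul1r; apply; rewrite /b; lra.
have h2 : K * frob_norm (H X) <= kappa ^+ 2.
  have : K / kappa ^+ 2 * frob_norm (H X) <= 1 by apply: le_b; rewrite /b; lra.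
  by rewrite mulrAC ler_pdivrMr ?exprn_gt0 // mul1r.
have h3 : c2 * frob_norm (H X) <= 1 by apply: le_b; rewrite /b; lra.
have h4 : 2 / kappa * frob_norm (H X) <= r.
  have : 2 / kappa / r * frob_norm (H X) <= 1 by apply: le_b; rewrite /b; lra.
  by rewrite mulrAC ler_pdivrMr // mul1r.
have h5 : (C3 ^+ 2 + c2) * frob_norm (H X) <= 2^-1 - sigma.
  have : (C3 ^+ 2 + c2) / (2^-1 - sigma) * frob_norm (H X) <= 1.
    by apply: le_b; rewrite /b; lra.
  by rewrite mulrAC ler_pdivrMr // mul1r.
have [ar HH mv] := unit_step ZX dX sd erefl h1 h2 h3 h4 h5.
have -> : lk = 0%N by case: lk arN => // lk /(_ 0%N (ltn0Sn _)).
rewrite expr0 scale1r; split=> //.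
have : 2 * C3 * frob_norm (H X) <= 1 by apply: le_b; rewrite /b; lra.
lra.
Qed.

End Local.

Section Sequence.
Variables (X : nat -> V) (Xs : V).
Hypothesis gnX : gauss_newton_sequence A0 A lam Ro beta etamax sigma X.
Hypothesis Zs : Zset Xs.
Hypothesis clX : cluster (X @ \oo) Xs.
Hypothesis surj : DH_surjective A0 A lam Xs.

Lemma iterates_Zset k : Zset (X k).
Proof.
elim: k => [|k IH]; first exact: gnX.1.
have [d [lk [sd _ _ ->]]] := gnX.2 k.
apply: retractZ_range => //; apply: tangentZZ.
exact: (search_direction_tangent hA0 hA IH sd).
Qed.

Lemma hfun_nonincreasing j k : (j <= k)%N -> h (X k) <= h (X j).
Proof.
move=> /subnK<-; elim: (k - j)%N => [//|i IH]; rewrite addSn.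
apply: le_trans IH; have [d [lk [sd ar _ ->]]] := gnX.2 (i + j)%N.
rewrite -subr_le0; apply: le_trans ar _.
have := search_direction_descent (eta_ge0 A0 A lam hetamax _) ler01 sd.
rewrite oppr0 mul0r => desc; rewrite mulr_ge0_le0 // mulr_ge0 //.
  by case/andP: hsigma => /ltW.
by rewrite exprn_ge0 //; case/andP: hbeta => /ltW.
Qed.

Lemma cluster_frequently (rho : R) N : 0 < rho ->
  exists2 k, (N <= k)%N & metric_norm (X k - Xs) < rho.
Proof.
move=> rho0.
have tailN : (X @ \oo) (X @` [set k | (N <= k)%N]) by exists N => // k Nk; exists k.
have [_ [[k Nk <-] near_k]] := clX tailN (nbhs_metric_ball Xs rho0).
by exists k.
Qed.

(** If H Xs were nonzero, the infinitely many iterates near Xs would each lower h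
    by a fixed amount, whereas h is nonnegative. *)
Lemma cluster_residual_zero : H Xs = 0.
Proof.
have [r [K [kappa [L model]]]] := local_model_exists hRo Zs surj.
have [/eqP e|n0] := boolP (frob_norm (H Xs) == 0); first exact: frob_norm_eq0.
exfalso; pose eps := frob_norm (H Xs) / 2.
have eps0 : 0 < eps by rewrite divr_gt0 // lt_def n0 frob_norm_ge0.
have Hs : frob_norm (H Xs) = 2 * eps by rewrite /eps mulrCA mulfV ?mulr1.
have [rho [theta [rho0 theta0 dec]]] := uniform_decrease model Zs eps0 Hs.
have drop q : exists k, h (X k) <= h (X 0%N) - q%:R * theta.
  elim: q => [|q [k IH]]; first by exists 0%N; rewrite mul0r subr0.
  have [k' kk' near_k'] := cluster_frequently k rho0.
  have [d [lk [sd ar arN E]]] := gnX.2 k'.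
  exists k'.+1; rewrite E.
  apply: le_trans (dec _ _ _ (iterates_Zset k') (ltW near_k') sd ar arN) _.
  by have := hfun_nonincreasing kk'; rewrite -[in q.+1%:R]addn1 natrD mulrDl mul1r; lra.
have [k hk] := drop (Num.bound (h (X 0%N) / theta)).
have h0 Y : 0 <= h Y by rewrite /h mulr_ge0 ?sqr_ge0 ?invr_ge0.
have := archi_boundP (divr_ge0 (h0 (X 0%N)) (ltW theta0)).
rewrite ltr_pdivrMr // => lt; have := h0 (X k); lra.
Qed.

(** The potential |X k - Xs| + 2 C4 |H (X k)| cannot increase once it is small,
    which confines the sequence and makes it converge. *)
Lemma iterates_quadratic : exists2 C : R, 0 < C &
  (forall e, 0 < e -> exists N, forall k, (N <= k)%N -> metric_norm (X k - Xs) <= e) /\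
  (exists N, forall k, (N <= k)%N ->
    metric_norm (X k.+1 - Xs) <= C * metric_norm (X k - Xs) ^+ 2).
Proof.
have [r [K [kappa [L model]]]] := local_model_exists hRo Zs surj.
have Hs := cluster_residual_zero; have K0 : 0 < K := lt_le_trans ltr01 (lm_K model).
have [rho [C3 [C4 [/andP[rho0 rhor] C30 C40 step]]]] := quadratic_step model Zs Hs.
pose a k := frob_norm (H (X k)); pose P k := metric_norm (X k - Xs) + 2 * C4 * a k.
have a0 k : 0 <= a k by exact: frob_norm_ge0.
have Pd k : metric_norm (X k - Xs) <= P k by rewrite lerDl !mulr_ge0 // ltW.
have next k : P k <= rho -> [/\ a k.+1 <= C3 * a k ^+ 2, a k.+1 <= 2^-1 * a k &
    metric_norm (X k.+1 - X k) <= C4 * a k].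
  move=> Pk; have [d [lk [sd _ arN E]]] := gnX.2 k.
  have := step (X k) d lk (iterates_Zset k) (le_trans (Pd k) Pk) sd arN.
  rewrite -E => -[s1 s2 s3]; split=> //.
  by apply: le_trans s2 _; rewrite [a k ^+ 2]expr2 mulrA; apply: ler_wpM2r; [exact: a0|exact: s1].
have Pnext k : P k <= rho -> P k.+1 <= P k.
  move=> /next[_ s2 s3]; rewrite /P.
  have := metric_normD (X k.+1 - X k) (X k - Xs); rewrite addrA subrK.
  by have := ler_wpM2l (ltW C40) s2; lra.
have Pmono k j : P k <= rho -> P (j + k)%N <= P k.
  move=> Pk; elim: j => [|j IH]; [by rewrite add0n|rewrite addSn].
  by apply: (le_trans _ IH); apply: Pnext; apply: le_trans IH Pk.
have aK k : metric_norm (X k - Xs) <= r -> a k <= K * metric_norm (X k - Xs).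
  by move=> kr; have := lm_H model (iterates_Zset k) kr; rewrite Hs subr0.
pose c := 1 + 2 * C4 * K; have c0 : 0 < c by rewrite ltr_wpDr // !mulr_ge0 // ltW.
have Psmall e : 0 < e -> exists k, P k <= e.
  move=> e0; have m0 : 0 < Num.min r (e / c).
    by rewrite lt_min (lt_le_trans rho0 rhor) divr_gt0.
  have [k _ nk] := cluster_frequently 0%N m0; exists k.
  move: nk; rewrite lt_min => /andP[/ltW kr /ltW ke].
  rewrite ler_pdivlMr // in ke; apply: le_trans ke.
  have -> : metric_norm (X k - Xs) * c =
      metric_norm (X k - Xs) + 2 * C4 * (K * metric_norm (X k - Xs)) by rewrite /c; ring.
  rewrite lerD2l; apply: ler_wpM2l; last exact: aK.
  by rewrite mulr_ge0 // ltW.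
have conv e : 0 < e -> exists N, forall k, (N <= k)%N -> P k <= e.
  move=> e0; have m0 : 0 < Num.min e rho by rewrite lt_min e0.
  have [N] := Psmall _ m0; rewrite le_min => /andP[Pe Pr]; exists N => k /subnK<-.
  by apply: le_trans (Pmono N (k - N)%N Pr) Pe.
have [N0 HN0] := conv rho rho0.
(* Summing the geometrically decreasing steps from X k on. *)
have tail k : (N0 <= k)%N -> metric_norm (X k - Xs) <= 2 * C4 * a k.
  move=> Nk; have bnd j : metric_norm (X (j + k)%N - X k) + 2 * C4 * a (j + k)%N <= 2 * C4 * a k.
    elim: j => [|j IH]; first by rewrite add0n subrr metric_norm0 add0r.
    have [_ s2 s3] := next _ (HN0 (j + k)%N (leq_trans Nk (leq_addl _ _))).
    rewrite addSn; apply: le_trans IH.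
    have := metric_normD (X (j + k).+1 - X (j + k)%N) (X (j + k)%N - X k).
    by rewrite addrA subrK; have := ler_wpM2l (ltW C40) s2; lra.
  apply/ler_addgt0Pr => e e0; have [N HN] := conv e e0.
  have h1 := HN (N + k)%N (leq_addr _ _); have h2 := Pd (N + k)%N.
  have := metric_norm_sub (X (N + k)%N - Xs) (X (N + k)%N - X k).
  rewrite opprB addrC addrA subrK => h3.
  have := bnd N; have : 0 <= 2 * C4 * a (N + k)%N by rewrite !mulr_ge0 // ltW.
  lra.
exists (2 * C4 * (C3 * K ^+ 2)); first by rewrite !mulr_gt0 ?exprn_gt0.
split.
  move=> e e0; have [N HN] := conv e e0; exists N => k /HN; exact: le_trans.
exists N0 => k Nk; apply: le_trans (tail k.+1 (leqW Nk)) _.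
have [s1 _ _] := next k (HN0 k Nk).
have ak : a k <= K * metric_norm (X k - Xs).
  by apply: aK; apply: le_trans rhor; apply: le_trans (HN0 k Nk).
have s2 : a k ^+ 2 <= K ^+ 2 * metric_norm (X k - Xs) ^+ 2.
  by rewrite -exprMn ler_pXn2r ?nnegrE ?a0 // (le_trans (a0 k)).
have C4' : 0 <= 2 * C4 by rewrite mulr_ge0 // ltW.
apply: le_trans (ler_wpM2l C4' (le_trans s1 (ler_wpM2l (ltW C30) s2))) _.
by rewrite le_eqVlt; apply/orP; left; apply/eqP; ring.
Qed.

(** Near Xs the Riemannian distance and the ambient norm are equivalent, so the
    rates measured in the ambient norm carry over. *)
Lemma iterates_converge : converges_linearly X Xs /\ converges_quadratically X Xs.
Proof.
have [C C0 [conv [N1 quad]]] := iterates_quadratic.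
have [N2 HN2] := conv 1 ltr01.
have up k : (N2 <= k)%N -> (distZ (X k) Xs <= (4 * metric_norm (X k - Xs))%:E)%E.
  move=> /HN2 k1; apply: distZ_le => //; first exact: iterates_Zset.
  by have [_ + _] := frob_le_metric (X k - Xs) => /le_trans; apply.
have lo k : ((metric_norm (X k - Xs))%:E <= distZ (X k) Xs)%E by exact: distZ_ge.
have cv : converges_to X Xs.
  apply: (@squeeze_cvge _ _ _ _ (cst 0%E) _ (fun k => (4 * metric_norm (X k - Xs))%:E)).
  - near=> k; rewrite up ?andbT /=; last by near: k; exists N2.
    by apply: le_trans (lo k); rewrite lee_fin metric_norm_ge0.
  - exact: cvg_cst.
  - apply/fine_cvgP; split; first by near=> k.
    apply/cvgrPdist_le => e e0; have e4 : 0 < e / 4 by rewrite divr_gt0.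
    have [N HN] := conv _ e4; exists N => // k /= /HN.
    rewrite ler_pdivlMr // => hk; rewrite sub0r normrN ger0_norm ?mulr_ge0 ?metric_norm_ge0 //.
    by rewrite mulrC.
split; split=> //.
  exists 2^-1; first by lra.
  have d0 : 0 < (8 * C)^-1 by rewrite invr_gt0 mulr_gt0.
  have [N3 HN3] := conv _ d0.
  near=> k.
  have k1 : (N1 <= k)%N by near: k; exists N1.
  have k2 : (N2 <= k)%N by near: k; exists N2.
  have k3 : (N3 <= k)%N by near: k; exists N3.
  apply: le_trans (up k.+1 (leqW k2)) _.
  apply: le_trans (_ : (2^-1 * metric_norm (X k - Xs))%:E <= _)%E; last first.
    by rewrite EFinM lee_pmul2l ?fin_numE // lte_fin invr_gt0.
  have h3 : 8 * C * metric_norm (X k - Xs) <= 1.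
    by rewrite mulrC -ler_pdivlMr ?mulr_gt0 // mul1r; exact: HN3.
  rewrite lee_fin; have := quad k k1.
  have := ler_wpM2r (metric_norm_ge0 (X k - Xs)) h3; rewrite mul1r; lra.
exists (4 * C); first by rewrite mulr_gt0.
near=> k.
have k1 : (N1 <= k)%N by near: k; exists N1.
have k2 : (N2 <= k)%N by near: k; exists N2.
apply: le_trans (up k.+1 (leqW k2)) _.
apply: le_trans (_ : (4 * C * metric_norm (X k - Xs) ^+ 2)%:E <= _)%E.
  by rewrite lee_fin -mulrA ler_wpM2l // quad.
rewrite EFinM lee_pmul2l ?fin_numE // ?lte_fin ?mulr_gt0 //.
by rewrite expr2 EFinM expe2 lee_pmul // lee_fin metric_norm_ge0.
Unshelve. all: by end_near. Qed.

End Sequence.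

End Convergence.

(** * The theorem *)

Theorem theorem3p5 (R : realType) (l m p : nat)
  (A0 : 'M[R]_(m + p)) (A : 'I_l -> 'M[R]_(m + p)) (lam : 'I_m -> R)
  (hA0 : A0^T = A0) (hA : forall i, (A i)^T = A i)
  (hlam : forall i j : 'I_m, (i <= j)%N -> lam i <= lam j)
  (Ro : 'M[R]_(m + p) -> 'M[R]_(m + p) -> 'M[R]_(m + p))
  (hRo : is_retraction_orthogonal Ro)
  (beta etamax sigma : R)
  (hbeta : 0 < beta < 1) (hetamax : 0 < etamax < 1) (hsigma : 0 < sigma < 2^-1) :
  exists2 delta : R, 0 < delta &
    forall (X : nat -> ambient R l m p) (Xs : ambient R l m p),
      gauss_newton_sequence A0 A lam Ro beta etamax sigma X ->
      Zset Xs ->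
      cluster (X @ \oo) Xs ->
      DH_surjective A0 A lam Xs ->
      (frob_norm (Hmap A0 A lam Xs) < delta -> converges_linearly X Xs) /\
      (Hmap A0 A lam Xs = 0 -> converges_quadratically X Xs).
Proof.
(* H Xs will turn out to be zero, so it lies below any positive threshold. *)
exists 1 => // X Xs gnX Zs clX surj.
have [lin quad] :=
  iterates_converge hA0 hA hRo hbeta hetamax hsigma gnX Zs clX surj.
by split.
Qed.
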